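(* Let $A\in\mathbb C^{n\times n}$ and $b\in\mathbb C^n$. Let $\lambda_1,\dots,\lambda_m\in\mathbb C$ be points not lying in $\sigma(A)$, and let $\varkappa_0,\varkappa_1,\dots,\varkappa_m$ be nonnegative integers. Let $V\in\mathbb C^{n\times\hat n}$ satisfy $V^HV=\mathbf 1_{\hat n\times\hat n}$, and let the following vectors, taken all together, form a basis of the image of $V$: $$A^{i}b\ (0\le i\le\varkappa_0-1),\qquad (\lambda_k\mathbf 1-A)^{-j}b\ (1\le k\le m,\ 1\le j\le\varkappa_k).$$ Put $\widehat A=V^HAV$ and $\hat b=V^Hb$. Let $\sigma(\widehat A)$ consist of the (distinct) points $\hat\mu_1,\dots,\hat\mu_{\hat m}\in\mathbb C$, with algebraic multiplicities $\hat w_1,\dots,\hat w_{\hat m}$, and assume that none of $\lambda_1,\dots,\lambda_m$ belongs to $\sigma(\widehat A)$. Then for every $t\in\mathbb R$ $$\bigl\lVert\exp_t(A)b-V\exp_t(\widehat A)\hat b\bigr\rVert\le\max_{\substack{s\in[0,1]\\ \mu\in\operatorname{co}\{\hat\mu_1,\dots,\hat\mu_{\hat m}\}}}\biggl\lVert\Omega(A)[v(A)]^{-1}\frac{(v\exp_t)^{(\hat n)}\bigl((1-s)\mu\mathbf 1+sA\bigr)}{\hat n!}\,b\biggr\rVert,$$ where $\lVert\cdot\rVert$ is the Euclidean norm on $\mathbb C^n$ and $$v(\lambda)=\prod_{k=1}^{m}(\lambda-\lambda_k)^{\varkappa_k},\qquad \Omega(\lambda)=\prod_{k=1}^{\hat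 m}(\lambda-\hat\mu_k)^{\hat w_k}.$$
   Context: $\mathbf 1$ is an identity matrix, $B^H$ is the conjugate transpose, $\sigma(B)$ the spectrum, $\operatorname{co}M$ the convex hull of $M\subset\mathbb C$. $\exp_t(\lambda)=e^{\lambda t}$, and an analytic function $g$ of a matrix $B$ is $g(B)=\frac1{2\pi i}\int_\Gamma g(\lambda)(\lambda\mathbf 1-B)^{-1}d\lambda$ with $\Gamma$ enclosing $\sigma(B)$. $(v\exp_t)^{(\hat n)}$ is the $\hat n$-th derivative in $\lambda$ of $v(\lambda)e^{\lambda t}$. The function $t\mapsto\exp_t(A)b$ is called the vector impulse response of the system $x'=Ax+bu$, and $t\mapsto V\exp_t(\widehat A)\hat b$ is its reduced-order approximation. Since the listed vectors form a basis of the image of $V$, $\hat n=\sum_{k=0}^m\varkappa_k=\sum_{k=1}^{\hat m}\hat w_k$. *)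

(* Defs.v *)
From HB Require Import structures.
From mathcomp Require Import all_boot all_order all_algebra.
From mathcomp Require Import all_classical all_reals all_analysis.
From mathcomp Require Import complex.

Set Implicit Arguments.
Unset Strict Implicit.
Unset Printing Implicit Defensive.

Import Order.TTheory GRing.Theory Num.Theory.
Import numFieldNormedType.Exports.

Local Open Scope ring_scope.
Local Open Scope complex_scope.
Local Open Scope classical_set_scope.

Section Defs.
Context {R : realType}.
Local Notation C := R[i].

Definition cexp (z : C) : C :=
  (expR (complex.Re z))%:C * (cos (complex.Im z) +i* sin (complex.Im z)).

Definition exp_t (t : R) (z : C) : C := cexp (z * t%:C).

(* The n-th complex derivative: [C] is here a normed module over itself. *)
Definition cderiven (n : nat) (f : C -> C) : C -> C :=
  derive1n n (f : C^o -> C^o).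

(* The integral of f dz over the circle |z| = r, traversed once
   counterclockwise. *)
Definition circle_integral (r : R) (f : C -> C) : C :=
  let z theta := r%:C * cexp (0 +i* theta) in
  let F theta := f (z theta) * ('i%C * z theta) in
  (\int[lebesgue_measure]_(theta in `[0%R, 2 * pi]) complex.Re (F theta)) +i*
  (\int[lebesgue_measure]_(theta in `[0%R, 2 * pi]) complex.Im (F theta)).

Definition spectrum n (B : 'M[C]_n) : set C := [set z | eigenvalue B z].

Definition contour_radius n (B : 'M[C]_n) : R :=
  1 + \sum_i \sum_j Normc.normc (B i j).

(* g(B) = (2 pi i)^-1 \int_Gamma g(z) (z 1 - B)^-1 dz.  For entire g the value
   does not depend on the contour Gamma enclosing the spectrum of B; Gamma is
   taken to be the circle |z| = contour_radius B (see [contour_encloses]), so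
   the definition is meant for entire g only. *)
Definition matfun (g : C -> C) n (B : 'M[C]_n) : 'M[C]_n :=
  \matrix_(i, j) (((2 * pi)%:C * 'i%C)^-1 *
    circle_integral (contour_radius B)
      (fun z => g z * invmx (z%:M - B) i j)).

Definition enorm n (x : 'cV[C]_n) : R :=
  Num.sqrt (\sum_i Normc.normc (x i 0) ^+ 2).

Definition convex_hull (M : set C) : set C :=
  [set z | exists k (a : 'I_k -> R) (x : 'I_k -> C),
    [/\ forall i, 0 <= a i, \sum_i a i = 1, forall i, M (x i) &
        z = \sum_i (a i)%:C * x i]].

Definition is_max (S : set R) (M : R) : Prop := S M /\ ubound S M.

Definition mximage m n (V : 'M[C]_(m, n)) : {vspace 'cV[C]_m} :=
  limg (linfun (mulmx V : 'cV[C]_n -> 'cV[C]_m)).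

(* A^i b (0 <= i < kap0), followed by
   (lam_k 1 - A)^-j b (k < m, 1 <= j <= kap k). *)
Definition krylov_vectors n m (A : 'M[C]_n) (b : 'cV[C]_n) (lam : 'I_m -> C)
    (kap0 : nat) (kap : 'I_m -> nat) : seq 'cV[C]_n :=
  [seq A ^+ i *m b | i <- iota 0 kap0] ++
  [seq invmx ((lam k)%:M - A) ^+ j *m b | k <- enum 'I_m, j <- iota 1 (kap k)].

Definition root_prod m (c : 'I_m -> C) (e : 'I_m -> nat) (z : C) : C :=
  \prod_(k < m) (z - c k) ^+ e k.

Lemma contour_encloses n (B : 'M[C]_n) (z : C) :
  spectrum B z -> Normc.normc z < contour_radius B.
Proof.
move=> /eigenvalueP[v vB v0].
have normcE x : (Normc.normc x)%:C = `|x| :> C by [].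
rewrite -ltcR rmorphD rmorph1 normcE.
set T := \sum_j `|v 0 j|.
have T0 : 0 < T.
  have : 0 <= T by apply: sumr_ge0.
  rewrite le0r => /orP[/eqP T0|//]; case/eqP: v0.
  apply/matrixP => i j; rewrite ord1 mxE; apply/eqP; rewrite -normr_eq0.
  by apply/eqP; apply: (psumr_eq0P _ T0).
set S := (X in 1 + X); suff : `|z| * T <= S * T.
  by rewrite ler_pM2r// => /le_lt_trans; apply; rewrite ltrDr ltr01.
rewrite {1}/T mulr_sumr.
have -> : \sum_i `|z| * `|v 0 i| = \sum_i `|\sum_j v 0 j * B j i|.
  apply: eq_bigr => i _; rewrite -normrM.
  by move/matrixP/(_ 0 i): vB; rewrite !mxE => ->.
have -> : S = \sum_i \sum_j `|B j i|.
  by rewrite /S exchange_big rmorph_sum; apply: eq_bigr => i _; rewrite rmorph_sum.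
rewrite mulr_suml; apply: ler_sum => i _.
apply: (le_trans (ler_norm_sum _ _ _)); rewrite mulr_suml.
apply: ler_sum => j _; rewrite normrM mulrC ler_wpM2l//.
by rewrite /T (bigD1 j)//= lerDl sumr_ge0.
Qed.

End Defs.

(* Main.v *)
Require Import Defs.
From mathcomp Require Import all_boot all_order all_algebra.
From mathcomp Require Import all_classical all_reals all_analysis.
From mathcomp Require Import complex.
From mathcomp Require Import ring lra.

Import Order.TTheory GRing.Theory Num.Theory.
Import numFieldNormedType.Exports.

Local Open Scope ring_scope.
Local Open Scope complex_scope.
Local Open Scope classical_set_scope.
Local Open Scope sesquilinear_scope.

Set Implicit Arguments.
Unset Strict Implicit.
Unset Printing Implicit Defensive.

(** Write nh for the dimension of the reduced model, W for the adjoint of V, f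
    for exp_t, and Omega for the characteristic polynomial of Ah.

    The image of V is the set of all q(A) v(A)^-1 b with deg q < nh
    ([krylov_space]), and on such vectors the projection is exact:
    V q(Ah) v(Ah)^-1 W b = q(A) v(A)^-1 b ([krylov_exact]). Let q be the
    remainder of v f modulo Omega, that is, the polynomial of degree < nh that
    interpolates v f at the eigenvalues of Ah. By Cayley-Hamilton
    (v f)(Ah) = q(Ah), so that the reduced model computes q(A) v(A)^-1 b and the
    error is v(A)^-1 (v f - q)(A) b = Omega(A) v(A)^-1 d(A) b, where d is the
    divided difference of v f at these nh eigenvalues, counted with
    multiplicity, and a variable point
    ([polynomial_error]). By the Hermite-Genocchi formula d(A) is an integral
    over a simplex of volume 1/nh! of the nh-th derivative of v f at convex
    combinations (1 - s) mu + s A, and this gives the bound.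

    The proof replaces the integral over the simplex by nh one-dimensional mean
    value inequalities, one for each linear factor of Omega: dividing by
    X - mu costs one derivative, and on the j-th derivatives it gains the factor
    1/(j + 1) ([seminorm_divp_XsubC], iterated in [seminorm_divp_prod]). For this
    f is first replaced by its Taylor polynomials, for which divided
    differences are quotients of polynomials and everything is algebraic.

    The passage to the limit needs control of the contour integrals [matfun].
    On polynomials they give the usual polynomial of a matrix ([matfun_poly]),
    by a recursion in the power of z that comes from z (z - B)^-1 =
    1 + B (z - B)^-1. The same identity bounds the resolvent on the contour by
    a constant that does not depend on B ([resolvent_bounded]); so locally
    uniform convergence of functions on the complex plane implies uniform
    convergence of the matrix functions on bounded sets of matrices
    ([matfun_approximates]). This yields the limit, and also the continuity in
    (s, mu) which, on the compact product of an interval with a simplex of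
    barycentric coordinates, shows that the maximum is attained
    ([max_attained]). *)

(** * Norms of complex vectors and matrices *)

Section Norms.
Variable R : realType.
Local Notation C := R[i].
Local Notation nc := (@Normc.normc R).

Lemma ncE (x : C) : (nc x)%:C = `|x|. Proof. by []. Qed.

Lemma nc_ge0 (x : C) : 0 <= nc x.
Proof. by case: x => a b; rewrite sqrtr_ge0. Qed.

Lemma nc0 : nc 0 = 0. Proof. exact: Normc.normc0. Qed.
Lemma nc1 : nc 1 = 1. Proof. exact: Normc.normc1. Qed.
Lemma ncM (x y : C) : nc (x * y) = nc x * nc y. Proof. exact: Normc.normcM. Qed.
Lemma ncD (x y : C) : nc (x + y) <= nc x + nc y. Proof. exact: le_normcD. Qed.
Lemma ncN (x : C) : nc (- x) = nc x. Proof. exact: normcN. Qed.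

Lemma nc_real (r : R) : nc r%:C = `|r|.
Proof. by rewrite /= expr0n addr0 sqrtr_sqr. Qed.

Lemma ncX (x : C) k : nc (x ^+ k) = nc x ^+ k.
Proof. by elim: k => [|k IH]; rewrite ?expr0 ?nc1// !exprS ncM IH. Qed.

Lemma nc_sum (I : Type) (s : seq I) (P : pred I) (F : I -> C) :
  nc (\sum_(i <- s | P i) F i) <= \sum_(i <- s | P i) nc (F i).
Proof.
elim/big_rec2: _ => [|i y x _ le]; first by rewrite nc0.
by apply: le_trans (ncD _ _) _; rewrite lerD2l.
Qed.

Lemma nc_nat k : nc k%:R = k%:R.
Proof.
by rewrite -[k%:R](rmorph_nat (real_complex R)) nc_real ger0_norm.
Qed.

Lemma Re_le_nc (x : C) : `|complex.Re x| <= nc x.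
Proof. by case: x => a b /=; rewrite -sqrtr_sqr ler_wsqrtr// lerDl sqr_ge0. Qed.

Lemma Im_le_nc (x : C) : `|complex.Im x| <= nc x.
Proof. by case: x => a b /=; rewrite -sqrtr_sqr ler_wsqrtr// lerDr sqr_ge0. Qed.

Lemma nc_le_ReIm (x : C) : nc x <= `|complex.Re x| + `|complex.Im x|.
Proof.
case: x => a b /=; rewrite -ler_sqr ?nnegrE ?sqrtr_ge0 ?addr_ge0//.
rewrite sqr_sqrtr ?addr_ge0 ?sqr_ge0// sqrrD !real_normK ?num_real//.
by rewrite lerD2r lerDl mulrn_wge0// mulr_ge0.
Qed.

(** This is the norm that [contour_radius] is built on; it is submultiplicative,
    and so it serves for all estimates in which constants do not matter. *)
Definition mnorm m n (X : 'M[C]_(m, n)) : R := \sum_i \sum_j nc (X i j).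

Lemma mnorm_ge0 m n (X : 'M[C]_(m, n)) : 0 <= mnorm X.
Proof. by apply: sumr_ge0 => i _; apply: sumr_ge0 => j _; apply: nc_ge0. Qed.

Lemma nc_le_mnorm m n (X : 'M[C]_(m, n)) i j : nc (X i j) <= mnorm X.
Proof.
rewrite /mnorm (bigD1 i)//= (bigD1 j)//= -addrA lerDl addr_ge0//.
  by apply: sumr_ge0 => k _; apply: nc_ge0.
by apply: sumr_ge0 => k _; apply: sumr_ge0 => l _; apply: nc_ge0.
Qed.

Lemma mnorm_le m n (X : 'M[C]_(m, n)) e :
  (forall i j, nc (X i j) <= e) -> mnorm X <= (m * n)%:R * e.
Proof.
move=> le; apply: le_trans (_ : \sum_(i < m) \sum_(j < n) e <= _).
  by apply: ler_sum => i _; apply: ler_sum => j _.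
by rewrite !big_const_ord !iter_addr_0 -mulrnA mulr_natl mulnC.
Qed.

Lemma mnormD m n (X Y : 'M[C]_(m, n)) : mnorm (X + Y) <= mnorm X + mnorm Y.
Proof.
rewrite /mnorm -big_split; apply: ler_sum => i _ /=.
by rewrite -big_split; apply: ler_sum => j _; rewrite mxE ncD.
Qed.

Lemma mnormN m n (X : 'M[C]_(m, n)) : mnorm (- X) = mnorm X.
Proof.
by apply: eq_bigr => i _; apply: eq_bigr => j _; rewrite mxE ncN.
Qed.

Lemma mnormZ m n a (X : 'M[C]_(m, n)) : mnorm (a *: X) = nc a * mnorm X.
Proof.
rewrite mulr_sumr; apply: eq_bigr => i _; rewrite mulr_sumr.
by apply: eq_bigr => j _; rewrite mxE ncM.
Qed.

Lemma mnormM m n p (X : 'M[C]_(m, n)) (Y : 'M[C]_(n, p)) :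
  mnorm (X *m Y) <= mnorm X * mnorm Y.
Proof.
rewrite mulr_suml; apply: ler_sum => i _; rewrite mulr_suml.
apply: le_trans (_ : \sum_j \sum_k nc (X i k) * nc (Y k j) <= _).
  apply: ler_sum => j _; rewrite mxE; apply: le_trans (nc_sum _ _ _) _.
  by apply: ler_sum => k _; rewrite ncM.
rewrite exchange_big; apply: ler_sum => k _; rewrite -mulr_sumr.
rewrite ler_wpM2l ?nc_ge0// /mnorm [leRHS](bigD1 k)//= lerDl.
by apply: sumr_ge0 => l _; apply: sumr_ge0 => j _; apply: nc_ge0.
Qed.

Lemma mnormX n (X : 'M[C]_n.+1) k : mnorm (X ^+ k.+1) <= mnorm X ^+ k.+1.
Proof.
elim: k => [|k IH]; first by rewrite !expr1.
rewrite exprS [leRHS]exprS; apply: le_trans (mnormM _ _) _.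
by rewrite ler_wpM2l ?mnorm_ge0.
Qed.

Lemma enorm_ge0 n (x : 'cV[C]_n) : 0 <= enorm x.
Proof. exact: sqrtr_ge0. Qed.

Lemma enorm_sqr n (x : 'cV[C]_n) : enorm x ^+ 2 = \sum_i nc (x i 0) ^+ 2.
Proof. by rewrite sqr_sqrtr// sumr_ge0// => i _; rewrite sqr_ge0. Qed.

Lemma sum_CauchySchwarz n (a b : 'I_n -> R) :
  (\sum_i a i * b i) ^+ 2 <= (\sum_i a i ^+ 2) * (\sum_i b i ^+ 2).
Proof.
set g := \sum_i a i * b i; set al := \sum_i a i ^+ 2; set be := \sum_i b i ^+ 2.
have be_ge0 : 0 <= be by apply: sumr_ge0 => i _; rewrite sqr_ge0.
have [be0|be_gt0] := ltP 0 be; last first.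
  have be0 : be = 0 by apply/eqP; rewrite eq_le be_gt0.
  have b0 i : b i = 0.
    apply/eqP; rewrite -sqrf_eq0; apply/eqP.
    by apply: (psumr_eq0P _ be0) => // j _; rewrite sqr_ge0.
  by rewrite /g big1 ?be0 ?mulr0 ?expr0n// => i _; rewrite b0 mulr0.
(* The vector a, minus its projection on b, scaled to avoid a division. *)
have : 0 <= \sum_i (be * a i - g * b i) ^+ 2.
  by apply: sumr_ge0 => i _; rewrite sqr_ge0.
have -> : \sum_i (be * a i - g * b i) ^+ 2 = be * (al * be - g ^+ 2).
  have -> : be * (al * be - g ^+ 2) =
     be ^+ 2 * al - 2 * be * g * g + g ^+ 2 * be by ring.
  have -> : \sum_i (be * a i - g * b i) ^+ 2 = \sum_i (be ^+ 2 * a i ^+ 2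
      - 2 * be * g * (a i * b i) + g ^+ 2 * b i ^+ 2).
    by apply: eq_bigr => i _; ring.
  by rewrite big_split sumrB -!mulr_sumr.
by rewrite pmulr_rge0// subr_ge0.
Qed.

Lemma enorm_CauchySchwarz n (x y : 'cV[C]_n) :
  \sum_i nc (x i 0) * nc (y i 0) <= enorm x * enorm y.
Proof.
rewrite -[leRHS]ger0_norm ?mulr_ge0 ?enorm_ge0//.
apply: le_trans (ler_norm _) _.
by rewrite -ler_sqr ?nnegrE ?normr_ge0// !real_normK ?num_real//
  exprMn !enorm_sqr sum_CauchySchwarz.
Qed.

Lemma enormD n (x y : 'cV[C]_n) : enorm (x + y) <= enorm x + enorm y.
Proof.
rewrite -ler_sqr ?nnegrE ?addr_ge0 ?enorm_ge0// sqrrD !enorm_sqr.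
apply: le_trans (_ : \sum_i (nc (x i 0) + nc (y i 0)) ^+ 2 <= _).
  apply: ler_sum => i _; rewrite ler_sqr ?nnegrE ?addr_ge0 ?nc_ge0// mxE.
  exact: ncD.
under eq_bigr do rewrite sqrrD.
rewrite !big_split/= lerD2r lerD2l -mulr2n lerMn2r.
exact: enorm_CauchySchwarz.
Qed.

Lemma enorm_le_mnorm n (x : 'cV[C]_n) : enorm x <= mnorm x.
Proof.
rewrite -ler_sqr ?nnegrE ?enorm_ge0 ?mnorm_ge0// enorm_sqr.
have -> : mnorm x = \sum_i nc (x i 0).
  by apply: eq_bigr => i _; rewrite big_ord1.
rewrite [leRHS]expr2 mulr_suml; apply: ler_sum => i _.
rewrite expr2 ler_wpM2l ?nc_ge0// (bigD1 i)//= lerDl.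
by apply: sumr_ge0 => j _; apply: nc_ge0.
Qed.

Lemma enormN n (x : 'cV[C]_n) : enorm (- x) = enorm x.
Proof. by congr Num.sqrt; apply: eq_bigr => i _; rewrite mxE ncN. Qed.

Lemma enormZ n a (x : 'cV[C]_n) : enorm (a *: x) = nc a * enorm x.
Proof.
apply/eqP; rewrite -(eqrXn2 (n := 2)) ?mulr_ge0 ?enorm_ge0 ?nc_ge0//.
rewrite exprMn !enorm_sqr mulr_sumr; apply/eqP/eq_bigr => i _.
by rewrite mxE ncM exprMn.
Qed.

Lemma enorm_dist n (x y : 'cV[C]_n) : `|enorm x - enorm y| <= enorm (x - y).
Proof.
have le (u w : 'cV[C]_n) : enorm u - enorm w <= enorm (u - w).
  by rewrite lerBlDr; apply: le_trans (enormD _ _); rewrite subrK.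
by rewrite ler_norml le andbT lerNl opprB -(enormN (x - y)) opprB le.
Qed.

End Norms.

(** * The complex exponential and its Taylor polynomials *)

Section ComplexExponential.
Variable R : realType.
Local Notation C := R[i].
Local Notation nc := (@Normc.normc R).

Lemma cexp0 : cexp 0 = 1 :> C.
Proof. by rewrite /cexp /= expR0 cos0 sin0 mul1r. Qed.

Lemma cexpD (z w : C) : cexp (z + w) = cexp z * cexp w.
Proof.
case: z w => a b [c d]; rewrite /cexp /= expRD cosD sinD.
by congr (_ +i* _); ring.
Qed.

Lemma nc_cexp (z : C) : nc (cexp z) = expR (complex.Re z).
Proof.
rewrite /cexp ncM nc_real ger0_norm ?expR_ge0//=.
by rewrite cos2Dsin2 sqrtr1 mulr1.
Qed.

Lemma nc_cexp_le (z : C) : nc (cexp z) <= expR (nc z).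
Proof. by rewrite nc_cexp ler_expR; apply: le_trans (ler_norm _) (Re_le_nc _). Qed.

Lemma cexpN (z : C) : cexp (- z) * cexp z = 1.
Proof. by rewrite -cexpD addNr cexp0. Qed.

(** Derivatives of complex functions of a real variable, for which the integral
    and mean value theorems are available componentwise. *)
Definition is_cderive (f : R -> C) (r : R) (d : C) :=
  is_derive r (1 : R) (fun x => complex.Re (f x)) (complex.Re d) /\
  is_derive r (1 : R) (fun x => complex.Im (f x)) (complex.Im d).

Lemma is_cderive_cst c r : is_cderive (fun=> c) r 0.
Proof. by split; exact: is_derive_cst. Qed.

Lemma is_cderive_lin (w : C) r : is_cderive (fun r : R => r%:C * w) r w.
Proof.
case: w => a b; split=> /=.
  rewrite (_ : (fun _ => _) = (fun x : R => x * a)); last first.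
    by apply/funext => x; rewrite mul0r subr0.
  by apply: is_derive_eq; rewrite /GRing.scale/= mulr0 add0r mulr1.
rewrite (_ : (fun _ => _) = (fun x : R => x * b)); last first.
  by apply/funext => x; rewrite mul0r addr0.
by apply: is_derive_eq; rewrite /GRing.scale/= mulr0 add0r mulr1.
Qed.

Lemma RecD (x y : C) : complex.Re (x + y) = complex.Re x + complex.Re y.
Proof. by case: x y => a b []. Qed.

Lemma ImcD (x y : C) : complex.Im (x + y) = complex.Im x + complex.Im y.
Proof. by case: x y => a b []. Qed.

Lemma RecM (x y : C) : complex.Re (x * y) =
  complex.Re x * complex.Re y - complex.Im x * complex.Im y.
Proof. by case: x y => a b []. Qed.

Lemma ImcM (x y : C) : complex.Im (x * y) =
  complex.Re x * complex.Im y + complex.Im x * complex.Re y.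
Proof. by case: x y => a b []. Qed.

Lemma is_cderiveD f g r df dg : is_cderive f r df -> is_cderive g r dg ->
  is_cderive (fun x => f x + g x) r (df + dg).
Proof.
move=> [f1 f2] [g1 g2]; split.
  rewrite (_ : (fun _ => _) = (fun x => complex.Re (f x)) + (fun x => complex.Re (g x))).
    by rewrite RecD; apply: is_deriveD.
  by apply/funext => x; rewrite RecD.
rewrite (_ : (fun _ => _) = (fun x => complex.Im (f x)) + (fun x => complex.Im (g x))).
  by rewrite ImcD; apply: is_deriveD.
by apply/funext => x; rewrite ImcD.
Qed.

Lemma is_cderiveM f g r df dg : is_cderive f r df -> is_cderive g r dg ->
  is_cderive (fun x => f x * g x) r (df * g r + f r * dg).
Proof.
move=> [f1 f2] [g1 g2]; split.
  rewrite (_ : (fun _ => _) = (fun x => complex.Re (f x)) * (fun x => complex.Re (g x))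
    - (fun x => complex.Im (f x)) * (fun x => complex.Im (g x))).
    apply: is_derive_eq; rewrite RecD !RecM /GRing.scale/=; ring.
  by apply/funext => x; rewrite RecM.
rewrite (_ : (fun _ => _) = (fun x => complex.Re (f x)) * (fun x => complex.Im (g x))
    + (fun x => complex.Im (f x)) * (fun x => complex.Re (g x))).
  apply: is_derive_eq; rewrite ImcD !ImcM /GRing.scale/=; ring.
by apply/funext => x; rewrite ImcM.
Qed.

Lemma is_cderive_horner (p : {poly C}) f r df : is_cderive f r df ->
  is_cderive (fun x => p.[f x]) r (p^`().[f r] * df).
Proof.
move=> Hf; elim/poly_ind: p => [|p c IH].
  rewrite deriv0 horner0 mul0r (_ : (fun _ => _) = fun=> 0).
    exact: is_cderive_cst.
  by apply/funext => x; rewrite horner0.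
rewrite (_ : (fun _ => _) = fun x => p.[f x] * f x + c); last first.
  by apply/funext => x; rewrite hornerMXaddC.
rewrite derivMXaddC hornerD hornerMX.
rewrite (_ : _ * df = p^`().[f r] * df * f r + p.[f r] * df + 0); last by ring.
exact: is_cderiveD (is_cderiveM IH Hf) (is_cderive_cst c r).
Qed.

Lemma is_cderive_cexp f r df : is_cderive f r df ->
  is_cderive (fun x => cexp (f x)) r (cexp (f r) * df).
Proof.
move=> [f1 f2]; rewrite /cexp.
pose a x := complex.Re (f x); pose b x := complex.Im (f x).
have e1 : is_derive r (1 : R) (fun x => expR (a x)) (expR (a r) * complex.Re df).
  by apply: is_derive_eq.
have c1 : is_derive r (1 : R) (fun x => cos (b x)) (- sin (b r) * complex.Im df).
  by apply: is_derive_eq.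
have s1 : is_derive r (1 : R) (fun x => sin (b x)) (cos (b r) * complex.Im df).
  by apply: is_derive_eq.
split.
  rewrite (_ : (fun _ => _) = (fun x => expR (a x)) * (fun x => cos (b x))).
    apply: is_derive_eq; rewrite !RecM /GRing.scale/= -/(a r) -/(b r); ring.
  by apply/funext => x; rewrite RecM /= mul0r subr0.
rewrite (_ : (fun _ => _) = (fun x => expR (a x)) * (fun x => sin (b x))).
  apply: is_derive_eq; rewrite !ImcM !RecM /GRing.scale/= -/(a r) -/(b r); ring.
by apply/funext => x; rewrite ImcM /= mul0r addr0.
Qed.

Lemma real_mean_value (f df : R -> R) M :
  (forall x : R, is_derive x (1 : R) f (df x)) ->
  (forall x, 0 <= x <= 1 -> `|df x| <= M) -> `|f 1 - f 0| <= M.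
Proof.
move=> fd bd.
have [|c] := MVT ltr01 (fun x _ => fd x).
  apply: continuous_subspaceT => x; apply: differentiable_continuous.
  by apply/derivable1_diffP; case: (fd x).
rewrite in_itv/= => /andP[c0 c1] ->; rewrite subr0 mulr1.
by apply: bd; rewrite !ltW.
Qed.

(** There is no mean value theorem for complex values; treating the components
    separately costs a factor 2, which is harmless here. *)
Lemma complex_mean_value (f df : R -> C) M :
  (forall x, is_cderive f x (df x)) ->
  (forall x, 0 <= x <= 1 -> nc (df x) <= M) -> nc (f 1 - f 0) <= 2 * M.
Proof.
move=> fd bd; apply: le_trans (nc_le_ReIm _) _; rewrite !raddfB mulr_natl mulr2n.
apply: lerD.
  apply: (@real_mean_value (fun x => complex.Re (f x)) (fun x => complex.Re (df x))).
    by move=> x; case: (fd x).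
  by move=> x /bd; apply: le_trans; apply: Re_le_nc.
apply: (@real_mean_value (fun x => complex.Im (f x)) (fun x => complex.Im (df x))).
  by move=> x; case: (fd x).
by move=> x /bd; apply: le_trans; apply: Im_le_nc.
Qed.

End ComplexExponential.

Section TaylorExponential.
Variable R : realType.
Local Notation C := R[i].
Local Notation nc := (@Normc.normc R).

Definition taylor_exp (t : R) N : {poly C} :=
  \poly_(k < N.+1) (t%:C ^+ k / k`!%:R).

Lemma taylor_exp_deriv t N :
  deriv (taylor_exp t N.+1) = t%:C *: taylor_exp t N.
Proof.
apply/polyP => k; rewrite coef_deriv coefZ !coef_poly ltnS.
case: ltnP => _; last by rewrite mul0rn mulr0.
rewrite exprS factS natrM -mulr_natr.
have h1 : k.+1%:R != 0 :> C by rewrite pnatr_eq0.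
have h2 : k`!%:R != 0 :> C by rewrite pnatr_eq0 -lt0n fact_gt0.
by field; apply/andP.
Qed.

Lemma taylor_expS t N :
  taylor_exp t N.+1 = taylor_exp t N + (t%:C ^+ N.+1 / (N.+1)`!%:R) *: 'X^(N.+1).
Proof.
apply/polyP => k; rewrite coefD coefZ coefXn !coef_poly ltnS leq_eqVlt.
case: eqVneq => [->|ne] /=; first by rewrite ltnn mulr1 add0r.
by rewrite mulr0 addr0.
Qed.

(** Let w = z t and let E be the N-th Taylor polynomial of the exponential. On
    [0, 1] the function r |-> cexp (- r w) E (r w) starts at 1, and its derivative
    is small since E differs from its own derivative by the last term only. *)
Lemma nc_taylor_exp t N (z : C) :
  nc (cexp (z * t%:C) - (taylor_exp t N).[z]) <=
  2 * expR (2 * nc (z * t%:C)) * (nc (z * t%:C) ^+ N.+1 / N`!%:R).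
Proof.
have eval M x : (taylor_exp t M).[x] = (taylor_exp 1 M).[x * t%:C].
  rewrite !horner_poly; apply: eq_bigr => k _.
  by rewrite exprMn expr1n; ring.
rewrite eval; set w := z * _; pose E := taylor_exp 1.
pose f r := cexp (r%:C * - w) * (E N).[r%:C * w].
pose df (r : R) := cexp (r%:C * - w) * (- w * (r%:C * w) ^+ N / N`!%:R).
have fd x : is_cderive f x (df x).
  have -> : df x = cexp (x%:C * - w) * (- w) * (E N).[x%:C * w]
      + cexp (x%:C * - w) * ((deriv (E N)).[x%:C * w] * w).
    have -> : deriv (E N) = E N - (N`!%:R^-1) *: 'X^N.
      rewrite /E; case: (N) => [|M].
        have -> : taylor_exp 1 0 = 1.
          by apply/polyP => -[|k]; rewrite coef_poly coef1//= expr0 fact0 divr1.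
        by rewrite -polyC1 derivC fact0 invr1 expr0 scale1r subrr.
      rewrite taylor_exp_deriv taylor_expS scale1r expr1n mul1r.
      by rewrite addrK.
    by rewrite hornerD hornerN hornerZ hornerXn /df; ring.
  apply: is_cderiveM; last first.
    exact/is_cderive_horner/is_cderive_lin.
  exact/is_cderive_cexp/is_cderive_lin.
have bd x : 0 <= x <= 1 -> nc (df x) <= expR (nc w) * (nc w ^+ N.+1 / N`!%:R).
  move=> /andP[x0 x1]; have x_le1 : nc x%:C <= 1 by rewrite nc_real ger0_norm.
  rewrite ncM; apply: ler_pM; rewrite ?nc_ge0//.
    apply: le_trans (nc_cexp_le _) _; rewrite ler_expR ncM ncN.
    by rewrite ler_piMl ?nc_ge0.
  rewrite ncM Normc.normcV nc_nat ler_wpM2r ?invr_ge0//.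
  rewrite ncM ncN exprS ler_wpM2l ?nc_ge0// ncX.
  by rewrite lerXn2r ?nnegrE ?nc_ge0// ncM ler_piMl ?nc_ge0.
have := complex_mean_value fd bd.
have f0 : f 0 = 1.
  rewrite /f !mul0r cexp0 mul1r horner_poly big_ord_recl expr0 fact0 divr1.
  by rewrite big1 ?addr0 ?mulr1// => i _; rewrite expr0n mulr0.
rewrite f0 /f !mul1r => le.
have -> : cexp w - (E N).[w] = - (cexp w * (cexp (- w) * (E N).[w] - 1)).
  by rewrite mulrBr mulrA [cexp w * cexp _]mulrC cexpN mul1r mulr1 opprB.
rewrite ncN ncM; apply: le_trans (ler_pM _ _ (nc_cexp_le _) le) _;
  rewrite ?nc_ge0//.
have -> : expR (2 * nc w) = expR (nc w) * expR (nc w).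
  by rewrite -expRD -mulr2n mulr_natl.
by rewrite le_eqVlt; apply/orP; left; apply/eqP; ring.
Qed.

End TaylorExponential.

Section ComplexDerivatives.
Variable R : realType.
Local Notation C := R[i].
Local Notation nc := (@Normc.normc R).

Lemma exp_tD (t : R) (z w : C) : exp_t t (z + w) = exp_t t z * exp_t t w.
Proof. by rewrite /exp_t mulrDl cexpD. Qed.

(** By the addition theorem only the derivative at 0 matters; there the
    estimate of [nc_taylor_exp] for the polynomial of degree 1 shows that the
    remainder is quadratic. *)
Lemma is_derive_exp_t (t : R) (z : C) :
  is_derive (z : C^o) (1 : C^o) (exp_t t : C^o -> C^o) (t%:C * exp_t t z).
Proof.
pose K := 2 * expR (2 * `|t|) * `|t| ^+ 2 * nc (exp_t t z) + 1.
have K_gt0 : 0 < K.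
  by rewrite ltr_wpDl// !mulr_ge0 ?expR_ge0 ?nc_ge0.
have quad (h : C) : nc h <= 1 ->
    nc (exp_t t (h + z) - exp_t t z - t%:C * exp_t t z * h) <= K * nc h ^+ 2.
  move=> h1; rewrite exp_tD.
  have -> : exp_t t h * exp_t t z - exp_t t z - t%:C * exp_t t z * h =
      (exp_t t h - (taylor_exp t 1).[h]) * exp_t t z.
    rewrite horner_poly !big_ord_recl big_ord0 /= !expr0 !expr1 !fact0 factS fact0.
    by rewrite muln1 invr1; ring.
  rewrite ncM; have := nc_taylor_exp t 1 h.
  rewrite ncM nc_real factS fact0 muln1 divr1 exprMn => le.
  apply: le_trans (ler_wpM2r (nc_ge0 _) le) _.
  rewrite /K [leRHS]mulrDl mul1r ler_wpDr ?sqr_ge0//.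
  set a := nc h ^+ 2; set b := `|t| ^+ 2.
  rewrite (_ : _ * nc (exp_t t z) =
    2 * expR (2 * (nc h * `|t|)) * (a * b * nc (exp_t t z))); last by ring.
  rewrite (_ : 2 * expR (2 * `|t|) * _ * _ * _ =
    2 * expR (2 * `|t|) * (a * b * nc (exp_t t z))); last by ring.
  rewrite ler_wpM2r ?mulr_ge0 ?sqr_ge0 ?nc_ge0// ler_wpM2l// ler_expR.
  by rewrite ler_wpM2l// ler_piMl.
have lim : (fun h : C^o => h^-1 *: ((exp_t t : C^o -> C^o) (h *: (1 : C^o) + z)
    - exp_t t z)) @ (0 : C^o)^' --> (t%:C * exp_t t z : C^o).
  apply/cvgrPdist_le => -[e e'] /[dup] e_gt0.
  rewrite ltcE/= => /andP[/eqP e'0 e0]; rewrite {e'}e'0 in e_gt0 *.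
  have eK : 0 < (e / K)%:C :> C by rewrite ltcR divr_gt0.
  near=> h.
  have h_neq0 : h != 0 by near: h; exact: nbhs_dnbhs_neq.
  have h_le1 : `|h| <= 1 by near: h; apply: dnbhs0_le.
  have h_leK : `|h| <= (e / K)%:C by near: h; apply: dnbhs0_le.
  rewrite -ncE (lecR _ 1) in h_le1; rewrite -ncE lecR in h_leK.
  have hE : h *: (1 : C^o) = h by rewrite /GRing.scale/= mulr1.
  rewrite hE -ncE -[_ +i* 0]/(e%:C) lecR.
  have -> : t%:C * exp_t t z - h^-1 *: (exp_t t (h + z) - exp_t t z) =
      - (h^-1 * (exp_t t (h + z) - exp_t t z - t%:C * exp_t t z * h)).
    rewrite /GRing.scale/=; field; exact: h_neq0.
  have nh : 0 < nc h by rewrite -ltcR ncE normr_gt0.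
  rewrite ncN ncM Normc.normcV ler_pdivrMl//.
  apply: le_trans (quad _ h_le1) _; rewrite expr2 mulrCA ler_wpM2l ?nc_ge0//.
  by rewrite mulrC -ler_pdivlMr.
apply: DeriveDef; first by apply/cvg_ex; eexists; exact: lim.
by apply: cvg_lim => //.
Unshelve. all: by end_near.
Qed.

Lemma is_derive_poly_exp_t (t : R) (q : {poly C}) (z : C) :
  is_derive (z : C^o) (1 : C^o) (fun z => q.[z] * exp_t t z : C^o)
    ((deriv q + t%:C *: q).[z] * exp_t t z).
Proof.
have polyd (p : {poly C}) : is_derive (z : C^o) (1 : C^o)
    (fun z => p.[z] : C^o) (deriv p).[z].
  elim/poly_ind: p => [|p c IH].
    rewrite deriv0 horner0 (_ : (fun _ => _) = cst (0 : C^o)).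
      exact: is_derive_cst.
    by apply/funext => x; rewrite horner0.
  rewrite (_ : (fun _ => _) = (fun x : C^o => p.[x] : C^o) * (id : C^o -> C^o)
      + cst (c : C^o)).
    rewrite derivMXaddC; apply: is_derive_eq.
    by rewrite addr0 /GRing.scale/= mulr1 hornerD hornerMX; ring.
  by apply/funext => x; rewrite hornerMXaddC.
rewrite (_ : (fun _ => _) = (fun x : C^o => q.[x] : C^o) * (exp_t t : C^o -> C^o)).
  have e := is_derive_exp_t t z; have p := polyd q.
  apply: is_derive_eq; rewrite /GRing.scale/= hornerD hornerZ; ring.
by apply/funext.
Qed.

(** Differentiating [q * exp_t t] amounts to applying [q |-> q' + t q]. *)
Definition dexp (t : R) (q : {poly C}) : {poly C} := deriv q + t%:C *: q.

Lemma cderiven_poly_exp_t (t : R) k (q : {poly C}) :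
  cderiven k (fun z => q.[z] * exp_t t z) =
  fun z => (iter k (dexp t) q).[z] * exp_t t z.
Proof.
rewrite /cderiven; elim: k => [//|k IH]; rewrite derive1nS IH.
apply/funext => z; rewrite derive1E.
by have d := is_derive_poly_exp_t t (iter k (dexp t) q) z; rewrite derive_val.
Qed.

End ComplexDerivatives.

(** * Complex integrals along a circle *)

Section ContourIntegral.
Variable R : realType.
Local Notation C := R[i].
Local Notation nc := (@Normc.normc R).
Local Notation mu := (@lebesgue_measure R).

Section ComplexContinuity.
Variable T : topologicalType.
Implicit Types f g : T -> C.

(** Continuity of both components, which is what the real integration theorems
    ask for. *)
Definition ccontinuous (f : T -> C) :=
  continuous (fun x => complex.Re (f x)) /\ continuous (fun x => complex.Im (f x)).

Lemma ccontinuous_cst c : ccontinuous (fun=> c).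
Proof. by split=> x; exact: cvg_cst. Qed.

Lemma ccontinuousD f g : ccontinuous f -> ccontinuous g ->
  ccontinuous (fun x => f x + g x).
Proof.
move=> [f1 f2] [g1 g2]; split=> x.
  under eq_fun do rewrite RecD.
  by apply: cvgD; [exact: f1|exact: g1].
under eq_fun do rewrite ImcD.
by apply: cvgD; [exact: f2|exact: g2].
Qed.

Lemma ccontinuousM f g : ccontinuous f -> ccontinuous g ->
  ccontinuous (fun x => f x * g x).
Proof.
move=> [f1 f2] [g1 g2]; split=> x.
  under eq_fun do rewrite RecM.
  apply: cvgB; apply: cvgM;
    [exact: f1|exact: g1|exact: f2|exact: g2].
under eq_fun do rewrite ImcM.
apply: cvgD; apply: cvgM;
  [exact: f1|exact: g2|exact: f2|exact: g1].
Qed.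

Lemma ccontinuousZ c f : ccontinuous f -> ccontinuous (fun x => c * f x).
Proof. by move=> cf; apply: ccontinuousM => //; exact: ccontinuous_cst. Qed.

Lemma ccontinuous_sum (I : Type) (s : seq I) (P : pred I) (f : I -> T -> C) :
  (forall i, ccontinuous (f i)) ->
  ccontinuous (fun x => \sum_(i <- s | P i) f i x).
Proof.
move=> cf; elim: s => [|i s IH].
  by under eq_fun do rewrite big_nil; exact: ccontinuous_cst.
under eq_fun do rewrite big_cons; case: (P i) => //.
exact: ccontinuousD.
Qed.

Lemma ccontinuous_prod (I : Type) (s : seq I) (P : pred I) (f : I -> T -> C) :
  (forall i, ccontinuous (f i)) ->
  ccontinuous (fun x => \prod_(i <- s | P i) f i x).
Proof.
move=> cf; elim: s => [|i s IH].
  by under eq_fun do rewrite big_nil; exact: ccontinuous_cst.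
under eq_fun do rewrite big_cons; case: (P i) => //.
exact: ccontinuousM.
Qed.

Lemma ccontinuousX f k : ccontinuous f -> ccontinuous (fun x => f x ^+ k).
Proof.
move=> cf; elim: k => [|k IH].
  by under eq_fun do rewrite expr0; exact: ccontinuous_cst.
by under eq_fun do rewrite exprS; exact: ccontinuousM.
Qed.

Lemma ccontinuous_horner (p : {poly C}) f :
  ccontinuous f -> ccontinuous (fun x => p.[f x]).
Proof.
move=> cf; under eq_fun do rewrite horner_coef.
apply: ccontinuous_sum => i; apply: ccontinuousM; last exact: ccontinuousX.
exact: ccontinuous_cst.
Qed.

Lemma ccontinuousV f : ccontinuous f -> (forall x, f x != 0) ->
  ccontinuous (fun x => (f x)^-1).
Proof.
move=> [f1 f2] f0.
pose d x := complex.Re (f x) ^+ 2 + complex.Im (f x) ^+ 2.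
have d0 x : d x != 0.
  rewrite /d; case: (f x) (f0 x) => a b; rewrite eq_complex /= negb_and => ab.
  by rewrite paddr_eq0 ?sqr_ge0// !sqrf_eq0 negb_and.
have cd x : d y @[y --> x] --> d x.
  by apply: cvgD; apply: cvgM; by [exact: f1|exact: f2].
have fV x : (f x)^-1 = (complex.Re (f x) / d x) +i* (- complex.Im (f x) / d x).
  apply: (mulfI (f0 x)); rewrite divff//; move: (d0 x); rewrite /d.
  case: (f x) => a b /= ab.
  apply/eqP; rewrite eq_complex/=; apply/andP; split; apply/eqP; field; exact: ab.
split=> x.
  under eq_fun do rewrite fV /=.
  by apply: cvgM; [exact: f1|apply: cvgV; [exact: d0|exact: cd]].
under eq_fun do rewrite fV /=.
by apply: cvgM; [apply: cvgN; exact: f2|apply: cvgV; [exact: d0|exact: cd]].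
Qed.

Lemma ccontinuous_real (f : T -> R) : continuous f -> ccontinuous (fun x => (f x)%:C).
Proof. by move=> cf; split=> x; [exact: cf|exact: cvg_cst]. Qed.

Lemma ccontinuous_cexp f : ccontinuous f -> ccontinuous (fun x => cexp (f x)).
Proof.
move=> [f1 f2]; apply: ccontinuousM.
  apply: ccontinuous_real => x; apply: continuous_comp; [exact: f1|].
  exact: continuous_expR.
split=> x; apply: continuous_comp; [exact: f2|exact: continuous_cos|
  exact: f2|exact: continuous_sin].
Qed.

End ComplexContinuity.
Arguments ccontinuous_cst {T} c.

Lemma is_cderive_continuous f df : (forall x, is_cderive f x (df x)) ->
  ccontinuous f.
Proof.
by move=> fd; split=> x; apply: differentiable_continuous;
  apply/derivable1_diffP; case: (fd x) => [] [].
Qed.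

(** The integral that occurs in [circle_integral], for an arbitrary integrand
    along one turn. *)
Definition turn_integral (F : R -> C) : C :=
  (\int[mu]_(x in `[0%R, 2 * pi]) complex.Re (F x)) +i*
  (\int[mu]_(x in `[0%R, 2 * pi]) complex.Im (F x)).

Lemma turn_gt0 : 0 < 2 * pi :> R.
Proof. by rewrite mulr_gt0// pi_gt0. Qed.

Lemma turn_integrable (f : R -> R) : continuous f ->
  mu.-integrable `[0%R, 2 * pi] (EFin \o f).
Proof.
move=> cf; apply: continuous_compact_integrable; first exact: segment_compact.
exact: continuous_subspaceT.
Qed.

Lemma turn_integralD F G : ccontinuous F -> ccontinuous G ->
  turn_integral (fun x => F x + G x) = turn_integral F + turn_integral G.
Proof.
move=> [F1 F2] [G1 G2]; rewrite /turn_integral.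
under eq_Rintegral do rewrite RecD.
rewrite RintegralD//; try exact: turn_integrable.
under [X in _ +i* X = _]eq_Rintegral do rewrite ImcD.
by rewrite RintegralD//; exact: turn_integrable.
Qed.

Lemma turn_integralZ c F : ccontinuous F ->
  turn_integral (fun x => c * F x) = c * turn_integral F.
Proof.
move=> [F1 F2]; rewrite /turn_integral; case: c => a b.
have int (c : R) f : continuous f ->
    mu.-integrable `[0%R, 2 * pi] (EFin \o (fun x => c * f x)).
  by move=> cf; apply: turn_integrable => x; apply: cvgM; [exact: cvg_cst|exact: cf].
under eq_Rintegral do rewrite RecM.
rewrite RintegralB//; try exact: int.
under [X in _ +i* X = _]eq_Rintegral do rewrite ImcM.
rewrite RintegralD//; try exact: int.
by rewrite !RintegralZl//; exact: turn_integrable.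
Qed.

Lemma turn_integral_sum (I : Type) (s : seq I) (F : I -> R -> C) :
  (forall i, ccontinuous (F i)) ->
  turn_integral (fun x => \sum_(i <- s) F i x) =
  \sum_(i <- s) turn_integral (F i).
Proof.
move=> cF; elim: s => [|i s IH].
  rewrite [RHS]big_nil; under [X in turn_integral X]eq_fun do rewrite big_nil.
  rewrite -[RHS](mul0r (turn_integral (fun=> 0))).
  rewrite -(turn_integralZ 0 (ccontinuous_cst 0)).
  by congr turn_integral; apply/funext => x; rewrite mulr0.
rewrite big_cons -IH -turn_integralD//; last exact: ccontinuous_sum.
by congr turn_integral; apply/funext => x; rewrite big_cons.
Qed.

(** The two components are bounded separately, hence 4 pi where 2 pi is
    optimal. *)
Lemma nc_turn_integral F M : ccontinuous F -> (forall x, nc (F x) <= M) ->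
  nc (turn_integral F) <= 4 * pi * M.
Proof.
move=> [F1 F2] leM; apply: le_trans (nc_le_ReIm _) _ => /=.
have bd f : continuous f -> (forall x, `|f x| <= M) ->
    `|\int[mu]_(x in `[0%R, 2 * pi]) f x| <= 2 * pi * M.
  move=> cf fM; apply: le_trans (le_normr_Rintegral _ (turn_integrable cf)) _.
    exact: measurable_itv.
  apply: le_trans (_ : \int[mu]_(x in `[0%R, 2 * pi]) M <= _).
    apply: le_Rintegral => //; apply: turn_integrable.
      by move=> x; apply: cvg_norm; exact: cf.
    by move=> x; exact: cvg_cst.
  have len : lebesgue_measure (`[0%R, 2 * pi] : set R) = (2 * pi)%:E.
    by rewrite lebesgue_measure_itv/= lte_fin turn_gt0 -EFinD subr0.
  rewrite Rintegral_cst// mulrC (_ : fine _ = 2 * pi)//.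
  exact: (congr1 (@fine R) len).
have -> : 4 * pi * M = 2 * pi * M + 2 * pi * M by ring.
by apply: lerD; apply: bd => // x; apply: le_trans (leM x);
  [exact: Re_le_nc|exact: Im_le_nc].
Qed.

Lemma turn_integral_derive F G : ccontinuous F ->
  (forall x, is_cderive G x (F x)) -> turn_integral F = G (2 * pi) - G 0.
Proof.
move=> [F1 F2] GF.
have ftc (f g : R -> R) : continuous f -> (forall x, is_derive x (1 : R) g (f x)) ->
    \int[mu]_(x in `[0%R, 2 * pi]) f x = g (2 * pi) - g 0.
  move=> cf gf; have cg : continuous g.
    move=> x; apply: differentiable_continuous; apply/derivable1_diffP.
    by case: (gf x).
  rewrite /Rintegral (continuous_FTC2 (f := f) (F := g) turn_gt0)//.
  - exact: continuous_subspaceT.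
  - split; [by move=> x _; case: (gf x)| | ].
      exact/cvg_at_right_filter/cg.
    exact/cvg_at_left_filter/cg.
  - by move=> x _; rewrite derive1E; have d := gf x; rewrite derive_val.
have := ftc _ _ F1 (fun x => proj1 (GF x)).
have := ftc _ _ F2 (fun x => proj2 (GF x)).
by rewrite /turn_integral => -> ->; case: (G _) (G 0) => a b [].
Qed.

End ContourIntegral.

Section CircleIntegral.
Variable R : realType.
Local Notation C := R[i].
Local Notation nc := (@Normc.normc R).

Lemma spectrumPn n (B : 'M[C]_n) z : ~ spectrum B z -> z%:M - B \in unitmx.
Proof.
rewrite /spectrum/= /eigenvalue /eigenspace kermx_eq0 => /negP; rewrite negbK.
by rewrite -row_free_unit /row_free -[_ - B]opprB eqmx_opp.
Qed.

Lemma le0_geometric (a K q : R) : 0 <= q -> q < 1 ->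
  (forall m, a <= K * q ^+ m) -> a <= 0.
Proof.
move=> q0 q1 le.
have cvg0 : (fun m => K * q ^+ m) @ \oo --> (K * 0).
  apply: cvgM; first exact: cvg_cst.
  by apply: cvg_expr; rewrite ger0_norm.
by rewrite mulr0 in cvg0; apply: (cvgr_to_ge cvg0); exact: nearW.
Qed.

Definition circle (r theta : R) : C := r%:C * cexp (0 +i* theta).

Lemma nc_circle r theta : 0 <= r -> nc (circle r theta) = r.
Proof. by move=> r0; rewrite ncM nc_cexp nc_real ger0_norm//= expR0 mulr1. Qed.

Lemma circle_neq0 r theta : 0 < r -> circle r theta != 0.
Proof.
move=> r0; apply/eqP => c0; have := nc_circle theta (ltW r0).
by rewrite c0 nc0 => e; rewrite -e ltxx in r0.
Qed.

Lemma circle_closed r : circle r (2 * pi) = circle r 0.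
Proof.
by rewrite /circle /cexp /= mulr_natl cos2pi sin2pi cos0 sin0.
Qed.

Lemma circleV r theta : (circle r theta)^-1 = circle r^-1 (- theta).
Proof.
rewrite /circle invfM -fmorphV; congr (_ * _).
have e : cexp (0 +i* theta) * cexp (0 +i* - theta) = 1.
  rewrite -cexpD (_ : _ + _ = 0) ?cexp0//.
  by apply/eqP; rewrite eq_complex/= addr0 subrr !eqxx.
by rewrite -[LHS]mulr1 -e mulKf//; apply: contraPneq e => ->;
  rewrite mul0r => /eqP; rewrite eq_sym oner_eq0.
Qed.

Lemma circle_cderive r theta :
  is_cderive (circle r) theta ('i%C * circle r theta).
Proof.
have E x : circle r x = r%:C * cexp (x%:C * 'i%C).
  congr (_ * cexp _); apply/eqP; rewrite eq_complex/= !(mulr0,mul0r,mulr1).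
  by rewrite subr0 addr0 !eqxx.
rewrite (_ : circle r = fun x => r%:C * cexp (x%:C * 'i%C)); last exact/funext.
rewrite (_ : _ * _ = 0 * cexp (theta%:C * 'i%C) +
   r%:C * (cexp (theta%:C * 'i%C) * 'i%C)); last by rewrite mul0r add0r; ring.
apply: is_cderiveM; first exact: is_cderive_cst.
exact/is_cderive_cexp/is_cderive_lin.
Qed.

Lemma circle_ccontinuous r : ccontinuous (circle r).
Proof. exact: is_cderive_continuous (circle_cderive r). Qed.

(** A form of continuity of g that transports along parametrized curves without
    any topology on the complex plane. *)
Definition preserves_ccontinuous (g : C -> C) :=
  forall f, ccontinuous f -> ccontinuous (fun x : R => g (f x)).

Lemma circle_integralE r f : circle_integral r f =
  turn_integral (fun x => f (circle r x) * ('i%C * circle r x)).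
Proof. by []. Qed.

Lemma antiderivative (p : {poly C}) : exists P : {poly C}, deriv P = p.
Proof.
exists (\poly_(k < (size p).+1) (p`_k.-1 / k%:R)).
apply/polyP => k; rewrite coef_deriv coef_poly ltnS.
case: ltnP => [lt|le] /=; last by rewrite mul0rn nth_default.
by rewrite -[LHS]mulr_natr divfK// pnatr_eq0.
Qed.

Lemma circle_integral_poly r (p : {poly C}) : circle_integral r (horner p) = 0.
Proof.
have [P dP] := antiderivative p; rewrite circle_integralE.
rewrite (turn_integral_derive (G := fun x => P.[circle r x])).
- by rewrite circle_closed subrr.
- apply: ccontinuousM; first exact/ccontinuous_horner/circle_ccontinuous.
  by apply: ccontinuousZ (circle_ccontinuous _).
- by move=> x; rewrite -dP; apply: is_cderive_horner (circle_cderive _ _).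
Qed.

Lemma circle_integralV r : 0 < r ->
  circle_integral r (fun z : C => z^-1) = (2 * pi)%:C * 'i%C.
Proof.
move=> r0; rewrite circle_integralE.
rewrite (turn_integral_derive (G := fun x => x%:C * 'i%C)).
- by rewrite mul0r subr0.
- rewrite (_ : (fun _ => _) = fun=> 'i%C); first exact: ccontinuous_cst.
  by apply/funext => x; rewrite mulrCA mulVf ?mulr1 ?circle_neq0.
- by move=> x; rewrite mulrCA mulVf ?mulr1 ?circle_neq0//; exact: is_cderive_lin.
Qed.

(** As for polynomials, the integrand has a primitive, here a power of 1/z; the
    inverse of a point on the circle is again an exponential. *)
Lemma circle_integralVX r m : 0 < r ->
  circle_integral r (fun z : C => z^-1 ^+ m.+2) = 0.
Proof.
move=> r0; rewrite circle_integralE.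
pose p : {poly C} := - (m.+1%:R^-1) *: 'X^(m.+1).
have circleVE x : (circle r x)^-1 = cexp (x%:C * - 'i%C) * r^-1%:C.
  rewrite circleV /circle mulrC; congr (cexp _ * _); apply/eqP.
  by rewrite eq_complex/=; apply/andP; split; apply/eqP; ring.
have d x : is_cderive (fun x => (circle r x)^-1) x (- 'i%C * (circle r x)^-1).
  rewrite (_ : (fun _ => _) = fun x => cexp (x%:C * - 'i%C) * r^-1%:C).
    have -> : - 'i%C * (circle r x)^-1 = cexp (x%:C * - 'i%C) * (- 'i%C) * r^-1%:C +
      cexp (x%:C * - 'i%C) * 0 by rewrite circleVE; ring.
    apply: is_cderiveM; last exact: is_cderive_cst.
    exact/is_cderive_cexp/is_cderive_lin.
  exact/funext.
rewrite (turn_integral_derive (G := fun x => p.[(circle r x)^-1])).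
- by rewrite circle_closed subrr.
- apply: ccontinuousM; last exact: ccontinuousZ (circle_ccontinuous _).
  by apply/ccontinuousX/ccontinuousV => [|x]; [exact: circle_ccontinuous|exact: circle_neq0].
- move=> x.
  have -> : (circle r x)^-1 ^+ m.+2 * ('i%C * circle r x) =
     (deriv p).[(circle r x)^-1] * (- 'i%C * (circle r x)^-1).
    rewrite derivZ derivXn hornerZ hornerMn hornerXn /= -[_ *+ m.+1]mulr_natl.
    rewrite !exprS; have c0 := circle_neq0 x r0.
    have m0 : m.+1%:R != 0 :> C by rewrite pnatr_eq0.
    by field; rewrite c0 addrC natr1 m0.
  by apply: is_cderive_horner.
Qed.

End CircleIntegral.

(** * The contour-integral functional calculus *)

Section FunctionalCalculus.
Variable R : realType.
Local Notation C := R[i].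
Local Notation nc := (@Normc.normc R).

Lemma ccontinuous_det (T : topologicalType) n (X : T -> 'M[C]_n) :
  (forall i j, ccontinuous (fun x => X x i j)) -> ccontinuous (fun x => \det (X x)).
Proof.
move=> cX; apply: ccontinuous_sum => s; apply: ccontinuousM.
  exact: ccontinuous_cst.
exact: ccontinuous_prod.
Qed.

Lemma ccontinuous_invmx (T : topologicalType) n (X : T -> 'M[C]_n) i j :
  (forall i j, ccontinuous (fun x => X x i j)) -> (forall x, X x \in unitmx) ->
  ccontinuous (fun x => invmx (X x) i j).
Proof.
move=> cX uX.
rewrite (_ : (fun _ => _) = fun x => (\det (X x))^-1 * ((-1) ^+ (j + i) *
    \det (row' j (col' i (X x))))); last first.
  by apply/funext => x; rewrite /invmx uX !mxE.
apply: ccontinuousM.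
  apply: ccontinuousV; first exact: ccontinuous_det.
  by move=> x; have := uX x; rewrite unitmxE unitfE.
apply: ccontinuousM; first exact: ccontinuous_cst.
by apply: ccontinuous_det => k l; under eq_fun do rewrite !mxE.
Qed.

Lemma horner_mx_poly n (B : 'M[C]_n.+1) N E :
  horner_mx B (\poly_(k < N) E k) = \sum_(k < N) E k *: B ^+ k.
Proof.
rewrite poly_def linear_sum; apply: eq_bigr => k _.
by rewrite linearZ /= rmorphXn/= horner_mx_X.
Qed.

Section Resolvent.
Variables (n : nat) (B : 'M[C]_n.+1).
Let r := contour_radius B.

Lemma contour_radius_ge1 : 1 <= r.
Proof. by rewrite lerDl mnorm_ge0. Qed.

Lemma contour_radius_gt0 : 0 < r.
Proof. exact: lt_le_trans ltr01 contour_radius_ge1. Qed.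

Lemma resolvent_unit x : (circle r x)%:M - B \in unitmx.
Proof.
apply: spectrumPn => /contour_encloses.
by rewrite nc_circle ?ltxx// ltW// contour_radius_gt0.
Qed.

Definition resolvent (z : C) : 'M[C]_n.+1 := invmx (z%:M - B).

(** This identity carries both the bound on the resolvent and the recursion for
    its moments. *)
Lemma resolventE x : circle r x *: resolvent (circle r x) =
  1%:M + B *m resolvent (circle r x).
Proof.
apply/eqP; rewrite -subr_eq -mul_scalar_mx -mulmxBl.
by rewrite mulmxV ?resolvent_unit.
Qed.

(** Taking norms in [resolventE] gives r y <= |1| + |B| y for the norm y of the
    resolvent, and the radius r of the contour is exactly 1 + |B|. So the bound
    is the same for all B. *)
Lemma resolvent_bounded x : mnorm (resolvent (circle r x)) <= n.+1%:R.
Proof.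
have r_gt0 := contour_radius_gt0; set Y := resolvent _.
have n1 : mnorm (1%:M : 'M[C]_n.+1) = n.+1%:R.
  transitivity (\sum_(i < n.+1) (1 : R)); last first.
    by rewrite big_const_ord iter_addr_0.
  apply: eq_bigr => i _; rewrite (bigD1 i)//= mxE eqxx nc1.
  by rewrite big1 ?addr0// => j ij; rewrite mxE eq_sym (negPf ij) nc0.
have : r * mnorm Y <= n.+1%:R + mnorm B * mnorm Y.
  rewrite -{1}(nc_circle x (ltW r_gt0)) -mnormZ resolventE -n1.
  by apply: le_trans (mnormD _ _) _; rewrite lerD2l mnormM.
by rewrite -lerBlDr -mulrBl /r /contour_radius -/(mnorm B) addrK mul1r.
Qed.

Lemma resolvent_ccontinuous i j : ccontinuous (fun x => resolvent (circle r x) i j).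
Proof.
apply: ccontinuous_invmx => [k l|x]; last exact: resolvent_unit.
under eq_fun do rewrite !mxE -mulr_natr.
apply: ccontinuousD; last exact: ccontinuous_cst.
apply: ccontinuousM; [exact: circle_ccontinuous|exact: ccontinuous_cst].
Qed.

Definition moment (g : C -> C) : 'M[C]_n.+1 :=
  \matrix_(i, j) circle_integral r (fun z => g z * resolvent z i j).

Lemma matfunE g : matfun g B = ((2 * pi)%:C * 'i%C)^-1 *: moment g.
Proof. by apply/matrixP => i j; rewrite !mxE. Qed.

Local Notation cc g := (ccontinuous (fun x => g (circle r x))).

Lemma integrand_ccontinuous g i j : cc g ->
  ccontinuous (fun x => g (circle r x) * resolvent (circle r x) i j *
     ('i%C * circle r x)).
Proof.
move=> cg; apply: ccontinuousM.
  exact: ccontinuousM cg (resolvent_ccontinuous i j).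
exact: ccontinuousZ (circle_ccontinuous r).
Qed.

Lemma moment_shift g : cc g ->
  moment (fun z => z * g z) = (circle_integral r g)%:M + B *m moment g.
Proof.
move=> cg; apply/matrixP => i j.
have cgi : ccontinuous (fun x => g (circle r x) * ('i%C * circle r x)).
  by apply: (ccontinuousM cg); exact: ccontinuousZ (circle_ccontinuous r).
have sumE : \sum_k B i k * moment g k j = turn_integral (fun x => \sum_k B i k *
    (g (circle r x) * resolvent (circle r x) k j * ('i%C * circle r x))).
  rewrite turn_integral_sum => [|k]; last first.
    exact: ccontinuousZ (integrand_ccontinuous k j cg).
  apply: eq_bigr => k _; rewrite mxE turn_integralZ//.
  exact: integrand_ccontinuous.
rewrite !mxE sumE -[_ *+ _]mulr_natl !circle_integralE -turn_integralZ//.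
rewrite -turn_integralD; last first.
- apply: ccontinuous_sum => k.
  exact: ccontinuousZ (integrand_ccontinuous k j cg).
- exact: ccontinuousZ cgi.
congr turn_integral; apply/funext => x.
have /matrixP/(_ i j) := resolventE x; rewrite !mxE => e.
rewrite (_ : _ * g _ * _ * _ = circle r x * resolvent (circle r x) i j *
   (g (circle r x) * ('i%C * circle r x))); last by ring.
rewrite e mulrDl mulr_suml; congr (_ + _).
by apply: eq_bigr => k _; ring.
Qed.

Lemma mnorm_moment g M : cc g -> (forall x, nc (g (circle r x)) <= M) ->
  mnorm (moment g) <= (n.+1 * n.+1)%:R * (4 * pi * (M * n.+1%:R * r)).
Proof.
move=> cg gM; apply: mnorm_le => i j; rewrite mxE circle_integralE.
apply: nc_turn_integral; first exact: integrand_ccontinuous.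
have r0 := contour_radius_gt0.
have nci : nc 'i%C = 1 by rewrite /= expr0n expr1n add0r sqrtr1.
move=> x; rewrite (ncM _ (_ * circle r x)) (ncM 'i%C) (ncM (g _)).
rewrite nci mul1r nc_circle ?(ltW r0)//.
rewrite ler_wpM2r ?(ltW r0)// ler_pM ?nc_ge0//.
exact: le_trans (nc_le_mnorm _ _ _) (resolvent_bounded x).
Qed.

(** Going down through the powers of 1/z with [moment_shift], only the first
    step meets a nonzero integral, that of 1/z; the rest after m steps is
    B^m times the moment of z^-m, which is O((|B| / r)^m) with |B| < r. *)
Lemma moment1 : moment (fun=> 1) = ((2 * pi)%:C * 'i%C)%:M.
Proof.
have r0 := contour_radius_gt0; have r1 := contour_radius_ge1.
have cV k : cc (fun z : C => z^-1 ^+ k).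
  by apply/ccontinuousX/ccontinuousV => [|x]; [exact: circle_ccontinuous|exact: circle_neq0].
have momV k : moment (fun z => z^-1 ^+ k) =
    (circle_integral r (fun z : C => z^-1 ^+ k.+1))%:M + B *m moment (fun z => z^-1 ^+ k.+1).
  rewrite -moment_shift//; apply/matrixP => i j; rewrite !mxE !circle_integralE.
  congr turn_integral; apply/funext => x; congr (_ * _ * _).
  by rewrite [in RHS]exprS mulVKf ?circle_neq0.
set c := _ * 'i%C.
have step m : moment (fun=> 1) = c%:M + B ^+ m.+1 *m moment (fun z => z^-1 ^+ m.+1).
  elim: m => [|m IH].
    have := momV 0; under eq_fun do rewrite expr0; move=> ->.
    by rewrite expr1; under eq_fun do rewrite expr1; rewrite circle_integralV.
  rewrite IH momV circle_integralVX// raddf0 add0r [in RHS]exprSr.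
  by rewrite mulmxA.
pose K := (n.+1 * n.+1)%:R * (4 * pi * (n.+1%:R * r)).
have le : mnorm (moment (fun=> 1) - c%:M) <= 0.
  apply: (@le0_geometric _ _ (K * (mnorm B / r)) (mnorm B / r)).
  - by rewrite divr_ge0 ?mnorm_ge0// ltW.
  - by rewrite ltr_pdivrMr// mul1r ltrDr.
  - move=> m; rewrite -mulrA -exprS (step m) addrAC subrr add0r.
    apply: le_trans (mnormM _ _) _.
    have mb := @mnorm_moment (fun z => z^-1 ^+ m.+1) (r^-1 ^+ m.+1) (cV _).
    apply: le_trans (ler_pM (mnorm_ge0 _) (mnorm_ge0 _) (mnormX B m) (mb _)) _.
      by move=> x; rewrite ncX Normc.normcV nc_circle// ltW.
    by rewrite expr_div_n exprVn le_eqVlt; apply/orP; left; apply/eqP; rewrite /K; ring.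
have m0 : mnorm (moment (fun=> 1) - c%:M) = 0.
  by apply/eqP; rewrite eq_le le mnorm_ge0.
apply/eqP; rewrite -subr_eq0; apply/eqP/matrixP => i j; rewrite [RHS]mxE.
apply: Normc.eq0_normc; apply/eqP; rewrite eq_le nc_ge0 andbT -m0.
exact: nc_le_mnorm.
Qed.

Lemma moment_poly (p : {poly C}) :
  moment (horner p) = ((2 * pi)%:C * 'i%C) *: horner_mx B p.
Proof.
set c := _ * 'i%C.
have momX k : moment (fun z => z ^+ k) = c *: B ^+ k.
  elim: k => [|k IH].
    have -> : (fun z : C => z ^+ 0) = fun=> 1 by apply/funext => z; rewrite expr0.
    by rewrite moment1 expr0 scalemx1.
  have -> : (fun z : C => z ^+ k.+1) = fun z => z * z ^+ k.
    by apply/funext => z; rewrite exprS.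
  rewrite moment_shift; last exact/ccontinuousX/circle_ccontinuous.
  have -> : circle_integral r (fun z : C => z ^+ k) = 0.
    rewrite -(circle_integral_poly r 'X^k); congr circle_integral.
    by apply/funext => z; rewrite hornerXn.
  by rewrite raddf0 add0r IH exprS -scalemxAr.
have -> : horner_mx B p = \sum_(k < size p) p`_k *: B ^+ k.
  by rewrite -[in LHS](coefK p) horner_mx_poly.
have cX k i j : ccontinuous (fun x => circle r x ^+ k *
    resolvent (circle r x) i j * ('i%C * circle r x)).
  exact: (@integrand_ccontinuous (fun z => z ^+ k) i j
    (ccontinuousX _ (circle_ccontinuous r))).
rewrite scaler_sumr; apply/matrixP => i j; rewrite summxE mxE circle_integralE.
transitivity (turn_integral (fun x => \sum_(k < size p) p`_k *
    (circle r x ^+ k * resolvent (circle r x) i j * ('i%C * circle r x)))).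
  congr turn_integral; apply/funext => x; rewrite horner_coef !mulr_suml.
  by apply: eq_bigr => k _; ring.
rewrite turn_integral_sum => [|k]; last first.
  exact: ccontinuousZ (cX k i j).
apply: eq_bigr => k _; rewrite turn_integralZ// scalerA [c * _]mulrC -scalerA -momX.
by rewrite !mxE.
Qed.

Lemma two_pi_i_neq0 : (2 * pi)%:C * 'i%C != 0 :> C.
Proof.
rewrite mulf_neq0//; last by rewrite eq_complex/= oner_eq0 andbF.
by rewrite eq_complex/= eqxx andbT gt_eqF// turn_gt0.
Qed.

Lemma matfun_poly (p : {poly C}) : matfun (horner p) B = horner_mx B p.
Proof. by rewrite matfunE moment_poly scalerA mulVf ?scale1r// two_pi_i_neq0. Qed.

Lemma matfun_approx (g : C -> C) (p : {poly C}) (e : R) :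
  preserves_ccontinuous g -> (forall z, nc z = r -> nc (g z - p.[z]) <= e) ->
  mnorm (matfun g B - horner_mx B p) <= 2 * n.+1%:R ^+ 3 * r * e.
Proof.
move=> cg le; rewrite -matfun_poly !matfunE -scalerBr.
have r0 := contour_radius_gt0.
have ccg : cc g by apply: cg; exact: circle_ccontinuous.
have ccp : cc (horner p) by apply: ccontinuous_horner; exact: circle_ccontinuous.
have ccd : cc (fun z => g z - p.[z]).
  apply: (ccontinuousD ccg).
  under eq_fun do rewrite -mulN1r.
  exact: ccontinuousZ ccp.
have -> : moment g - moment (horner p) = moment (fun z => g z - p.[z]).
  have -> : moment g = moment (fun z => g z - p.[z]) + moment (horner p).
    apply/matrixP => i j; rewrite !mxE !circle_integralE -turn_integralD.
    - congr turn_integral; apply/funext => x.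
      by rewrite -!mulrDl subrK.
    - exact: (@integrand_ccontinuous (fun z => g z - p.[z]) i j ccd).
    - exact: (@integrand_ccontinuous (horner p) i j ccp).
  by rewrite addrK.
rewrite mnormZ Normc.normcV ncM nc_real.
have -> : nc 'i%C = 1 by rewrite /= expr0n expr1n add0r sqrtr1.
rewrite mulr1 ger0_norm ?(ltW (turn_gt0 R))// ler_pdivrMl ?turn_gt0//.
apply: le_trans (@mnorm_moment (fun z => g z - p.[z]) e ccd _) _.
  by move=> x; apply: le; rewrite nc_circle// ltW.
rewrite le_eqVlt; apply/orP; left; apply/eqP; rewrite natrM; ring.
Qed.

End Resolvent.
End FunctionalCalculus.

Section LocallyUniformApproximation.
Variable R : realType.
Local Notation C := R[i].
Local Notation nc := (@Normc.normc R).

(** Locally uniform convergence on the complex plane. *)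
Definition approximates (P : nat -> {poly C}) (F : C -> C) :=
  forall rho e, 0 < e -> exists N0, forall N, (N0 <= N)%N -> forall z,
  nc z <= rho -> nc (F z - (P N).[z]) <= e.

Lemma approximatesD P Q F G : approximates P F -> approximates Q G ->
  approximates (fun N => P N + Q N) (fun z => F z + G z).
Proof.
move=> PF QG rho e e0; have e2 : 0 < e / 2 by rewrite divr_gt0.
have [N1 le1] := PF rho _ e2; have [N2 le2] := QG rho _ e2.
exists (maxn N1 N2) => N; rewrite geq_max => /andP[N1N N2N] z zr.
rewrite hornerD opprD addrACA [e in leRHS]splitr.
by apply: le_trans (ncD _ _) _; rewrite lerD ?le1 ?le2.
Qed.

Lemma nc_horner_le (q : {poly C}) rho z : nc z <= rho ->
  nc q.[z] <= \sum_(k < size q) nc q`_k * rho ^+ k.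
Proof.
move=> zr; rewrite horner_coef; apply: le_trans (nc_sum _ _ _) _.
apply: ler_sum => k _; rewrite ncM ncX ler_wpM2l ?nc_ge0//.
by rewrite lerXn2r ?nnegrE ?nc_ge0//; apply: le_trans zr; rewrite nc_ge0.
Qed.

Lemma approximatesM q P F : approximates P F ->
  approximates (fun N => q * P N) (fun z => q.[z] * F z).
Proof.
move=> PF rho e e0; pose K := \sum_(k < size q) nc q`_k * `|rho| ^+ k + 1.
have K0 : 0 < K.
  by rewrite ltr_wpDl// sumr_ge0// => k _; rewrite mulr_ge0 ?nc_ge0 ?exprn_ge0.
have eK : 0 < e / K by rewrite divr_gt0.
have [N0 le] := PF rho _ eK; exists N0 => N NN0 z zr.
rewrite hornerM -mulrBr ncM -(divfK (lt0r_neq0 K0) e) mulrC.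
rewrite ler_pM ?nc_ge0 ?le//.
apply: le_trans (nc_horner_le q (le_trans zr (ler_norm _))) _.
by rewrite /K lerDl.
Qed.

Lemma approximates_taylor_exp (t : R) c :
  approximates (fun N => taylor_exp t (N + c)) (exp_t t).
Proof.
move=> rho e e0; pose x := `|rho| * `|t|.
have x0 : 0 <= x by rewrite mulr_ge0.
pose K := 2 * expR (2 * x) * x + 1.
have K0 : 0 < K by rewrite ltr_wpDl// !mulr_ge0 ?expR_ge0.
have /cvgrPdist_le/(_ _ (divr_gt0 e0 K0))[N0 _ le] := cvg_exp_coeff x.
exists N0 => N NN0 z zr; apply: le_trans (nc_taylor_exp _ _ _) _.
have wx : nc (z * t%:C) <= x.
  rewrite ncM nc_real ler_wpM2r//; exact: le_trans zr (ler_norm _).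
have := le (N + c)%N (leq_trans NN0 (leq_addr _ _)).
rewrite sub0r normrN /exp_coeff ger0_norm; last first.
  by rewrite mulr_ge0 ?exprn_ge0 ?invr_ge0.
rewrite ler_pdivlMr// => {}le; apply: le_trans le.
set m := (N + c)%N.
apply: le_trans (_ : 2 * expR (2 * x) * (x ^+ m.+1 / m`!%:R) <= _).
  rewrite ler_pM ?mulr_ge0 ?expR_ge0 ?invr_ge0 ?exprn_ge0 ?nc_ge0//.
    by rewrite ler_wpM2l// ler_expR ler_wpM2l.
  by rewrite ler_wpM2r ?invr_ge0// lerXn2r ?nnegrE ?nc_ge0.
rewrite /K mulrDr mulr1 exprS.
rewrite (_ : _ * (_ * _ / _) = x ^+ m / m`!%:R * (2 * expR (2 * x) * x)); last by ring.
by rewrite lerDl mulr_ge0 ?exprn_ge0 ?invr_ge0.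
Qed.

Lemma iter_dexpD t k (p q : {poly C}) :
  iter k (dexp t) (p + q) = iter k (dexp t) p + iter k (dexp t) q.
Proof.
elim: k p q => [//|k IH] p q; rewrite !iterS IH /dexp derivD scalerDr.
by rewrite addrACA.
Qed.

(** Differentiating [taylor_exp t N.+1] gives t times [taylor_exp t N], so k
    derivatives shift the Taylor polynomials by at most k; the offset c >= k
    keeps the degrees nonnegative. *)
Lemma approximates_derivn t k c (q : {poly C}) : (k <= c)%N ->
  approximates (fun N => derivn k (q * taylor_exp t (N + c)))
    (fun z => (iter k (dexp t) q).[z] * exp_t t z).
Proof.
elim: k c q => [|k IH] c q kc.
  exact/approximatesM/approximates_taylor_exp.
case: c kc => [//|c] kc.
have -> : (fun N => derivn k.+1 (q * taylor_exp t (N + c.+1))) =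
    fun N => derivn k (deriv q * taylor_exp t (N + c.+1)) +
             derivn k ((t%:C *: q) * taylor_exp t (N + c)).
  apply/funext => N; rewrite derivSn derivM addnS taylor_exp_deriv -scalerAr.
  by rewrite scalerAl linearD.
have -> : (fun z => (iter k.+1 (dexp t) q).[z] * exp_t t z) =
    fun z => (iter k (dexp t) (deriv q)).[z] * exp_t t z +
             (iter k (dexp t) (t%:C *: q)).[z] * exp_t t z.
  by apply/funext => z; rewrite iterSr iter_dexpD hornerD mulrDl.
by apply: approximatesD; apply: IH => //; rewrite ltnW.
Qed.

Lemma preserves_exp_t (t : R) : preserves_ccontinuous (exp_t t).
Proof.
by move=> f cf; apply/ccontinuous_cexp/ccontinuousM => //; exact: ccontinuous_cst.
Qed.

Lemma preserves_poly_exp_t t (q : {poly C}) :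
  preserves_ccontinuous (fun z => q.[z] * exp_t t z).
Proof.
move=> f cf; apply: ccontinuousM; first exact: ccontinuous_horner.
exact: preserves_exp_t.
Qed.

(** The convergence is uniform over the ball of matrices because the contour
    stays in a fixed disc and the resolvent is bounded there uniformly in B. *)
Lemma matfun_approximates n P F rho e : approximates P F ->
  preserves_ccontinuous F -> 0 < e ->
  exists N0, forall N, (N0 <= N)%N -> forall B : 'M[C]_n.+1, mnorm B <= rho ->
  mnorm (matfun F B - horner_mx B (P N)) <= e.
Proof.
move=> PF cF e0; pose K := 2 * n.+1%:R ^+ 3 * (1 + `|rho|).
have K0 : 0 < K by rewrite !mulr_gt0// ?exprn_gt0// ltr_pwDl.
have [N0 le] := PF (1 + `|rho|) _ (divr_gt0 e0 K0).
exists N0 => N NN0 B Brho.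
have rK : contour_radius B <= 1 + `|rho|.
  by rewrite lerD2l; apply: le_trans Brho (ler_norm _).
apply: le_trans (matfun_approx cF (e := e / K) _) _.
  by move=> z zr; apply: le => //; rewrite zr.
rewrite -[leRHS](divfK (lt0r_neq0 K0)) mulrC ler_pM2l ?divr_gt0//.
by rewrite ler_wpM2l// mulr_ge0// exprn_ge0.
Qed.

End LocallyUniformApproximation.

(** * Divided differences *)

Section DividedDifferences.
Variable R : realType.
Local Notation C := R[i].
Local Notation nc := (@Normc.normc R).

Lemma conjc_mul_self (d : C) : d^*%C * d = (nc d ^+ 2)%:C.
Proof. by rewrite mulrC -sqr_normc -ncE rmorphXn. Qed.

Lemma nc_conjc (d : C) : nc d^*%C = nc d.
Proof. by case: d => a b /=; rewrite sqrrN. Qed.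

Lemma is_cderive_poly (G : {poly C}) (x : R) :
  is_cderive (fun x : R => G.[x%:C]) x (deriv G).[x%:C].
Proof.
have d1 := is_cderive_lin (1 : C) x.
have := is_cderive_horner G d1; rewrite !mulr1.
by under eq_fun do rewrite mulr1.
Qed.

(** With d the increment of G, the real function
    M |d| x^(j+1) / (j+1) - Re (conj d * G x) is nondecreasing on [0, 1].
    Projecting on the direction of d keeps the constant sharp, which is needed
    here since it ends up in the final bound. *)
Lemma poly_mean_value (G : {poly C}) j (M : R) :
  (forall x, 0 <= x <= 1 -> nc (deriv G).[x%:C] <= M * x ^+ j) ->
  nc (G.[1] - G.[0]) <= M / j.+1%:R.
Proof.
move=> le; set d := G.[1] - G.[0].
have [d0|d_gt0] := leP (nc d) 0.
  apply: le_trans d0 _; rewrite divr_ge0//.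
  by have := le 1; rewrite lexx ler01 expr1n mulr1 => /(_ isT); apply: le_trans (nc_ge0 _).
pose c := nc d / j.+1%:R * M.
pose q (x : R) := c * x ^+ j.+1 - complex.Re (d^*%C * G.[x%:C]).
pose dq (x : R) := nc d * M * x ^+ j - complex.Re (d^*%C * (deriv G).[x%:C]).
have qd x : is_derive x (1 : R) q (dq x).
  have [g _] := is_cderiveM (is_cderive_cst d^*%C x) (is_cderive_poly G x).
  rewrite mul0r add0r in g.
  have p := is_derive_poly (c *: 'X^(j.+1)) x.
  rewrite /q (_ : (fun _ => _) = horner (c *: 'X^(j.+1)) -
     (fun x => complex.Re (d^*%C * G.[x%:C]))); last first.
    by apply/funext => y; rewrite fctE hornerZ hornerXn.
  apply: is_derive_eq; rewrite /dq; congr (_ - _).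
  rewrite derivZ derivXn. rewrite hornerZ hornerMn hornerXn -[_ *+ _]mulr_natr /c.
  by field; rewrite addrC natr1 pnatr_eq0.
have qc : {within `[0%R, 1%R], continuous q}.
  apply: continuous_subspaceT => x; apply: differentiable_continuous.
  by apply/derivable1_diffP; case: (qd x).
have [x] := MVT ltr01 (fun x _ => qd x) qc.
rewrite in_itv/= => /andP[x0 x1] qe.
have dq_ge0 : 0 <= dq x.
  rewrite subr_ge0; apply: le_trans (ler_norm _) (le_trans (Re_le_nc _) _).
  by rewrite ncM nc_conjc -mulrA ler_wpM2l ?nc_ge0// le// !ltW.
rewrite subr0 mulr1 in qe; rewrite -qe /q expr1n mulr1 expr0n mulr0 in dq_ge0.
have : complex.Re (d^*%C * d) <= c.
  rewrite -subr_ge0; apply: le_trans dq_ge0 _; rewrite le_eqVlt.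
  apply/orP; left; apply/eqP; rewrite {2}/d mulrBr.
  have ReB (u w : C) : complex.Re (u - w) = complex.Re u - complex.Re w.
    by case: u w => ? ? [].
  by rewrite ReB; ring.
by rewrite conjc_mul_self/= expr2 /c -mulrA ler_pM2l// mulrC.
Qed.

Lemma horner_mx_translate n (B : 'M[C]_n.+1) mu (p : {poly C}) :
  horner_mx (mu%:M + B) p = horner_mx B (p \Po ('X + mu%:P)).
Proof.
elim/poly_ind: p => [|p c IH]; first by rewrite comp_poly0 !raddf0.
rewrite comp_polyD comp_polyM comp_polyX comp_polyC !rmorphD !rmorphM/= IH.
by rewrite !horner_mx_X rmorphD/= horner_mx_X !horner_mx_C [_%:M + B]addrC.
Qed.

Lemma derivn_translate k mu (p : {poly C}) :
  derivn k p \Po ('X + mu%:P) = derivn k (p \Po ('X + mu%:P)).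
Proof.
elim: k => [//|k IH]; rewrite !derivnS -IH deriv_comp.
by rewrite derivD derivX derivC addr0 mulr1.
Qed.

Lemma divp_translate (h : {poly C}) mu :
  h \Po ('X + mu%:P) = (h %/ ('X - mu%:P) \Po ('X + mu%:P)) * 'X + h.[mu]%:P.
Proof.
rewrite {1}(divp_eq h ('X - mu%:P)) modp_XsubC comp_polyD comp_polyM comp_polyC.
by rewrite comp_polyB comp_polyX comp_polyC addrK.
Qed.

Section Bound.
Variables (n q : nat) (K : 'M[C]_(q, n.+1)) (b : 'cV[C]_n.+1).

(** The maximum in the error bound is taken over values of this function, with
    K a multiple of Omega(A) v(A)^-1. *)
Definition seminorm (X : 'M[C]_n.+1) : R := enorm (K *m X *m b).

(** Scalar products with a fixed vector x: testing against x equal to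
    K X b itself reduces estimates of [seminorm] to scalar polynomials. *)
Let testf (x : 'cV[C]_q) (X : 'M[C]_n.+1) : C :=
  \sum_i (x i 0)^*%C * (K *m X *m b) i 0.

Let testf_sum x N (E : 'I_N -> C) (X : 'I_N -> 'M[C]_n.+1) :
  testf x (\sum_k E k *: X k) = \sum_k E k * testf x (X k).
Proof.
rewrite /testf mulmx_sumr mulmx_suml.
under eq_bigr => i _ do rewrite summxE mulr_sumr.
rewrite exchange_big; apply: eq_bigr => k _; rewrite mulr_sumr.
by apply: eq_bigr => i _; rewrite -scalemxAr -scalemxAl mxE mulrCA.
Qed.

Let nc_testf x X : nc (testf x X) <= enorm x * seminorm X.
Proof.
apply: le_trans (nc_sum _ _ _) _; apply: le_trans (enorm_CauchySchwarz _ _).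
by apply: ler_sum => i _; rewrite ncM nc_conjc.
Qed.

Let testf_self X : testf (K *m X *m b) X = (seminorm X ^+ 2)%:C.
Proof.
rewrite enorm_sqr rmorph_sum; apply: eq_bigr => i _.
by rewrite conjc_mul_self.
Qed.

(** Put T = h %/ (X - mu) and let B r = mu + r (B - mu). Up to a constant h is
    (X - mu) T, and comparing coefficients at mu shows that
    r |-> r^(j+1) T^(j)(B r) has the derivative r^j h^(j+1)(B r). It vanishes at
    r = 0 and takes the value T^(j)(B) at r = 1, so the mean value inequality
    applies. This is the bound that the formula
    T^(j)(B) = int_0^1 r^j h^(j+1)(B r) dr would give. *)
Lemma seminorm_divp_XsubC (h : {poly C}) mu (B : 'M[C]_n.+1) j (M : R) :
  (forall r : R, 0 <= r <= 1 ->
    seminorm (horner_mx (mu%:M + r%:C *: (B - mu%:M)) (derivn j.+1 h)) <= M) ->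
  seminorm (horner_mx B (derivn j (h %/ ('X - mu%:P)))) <= M / j.+1%:R.
Proof.
move=> le; set S := seminorm _.
have M0 : 0 <= M.
  by apply: le_trans (enorm_ge0 _) (le 0 _); rewrite lexx ler01.
have [S0|S_gt0] := leP S 0; first by apply: le_trans S0 _; rewrite divr_ge0.
set D := B - mu%:M; pose p0 := h %/ ('X - mu%:P) \Po ('X + mu%:P).
pose p := derivn j p0; pose N := size p.
have pE : p = \poly_(k < N) p`_k by rewrite coefK.
have hE : derivn j.+1 h \Po ('X + mu%:P) = \poly_(k < N) (p`_k *+ (k + j).+1).
  rewrite derivn_translate divp_translate -/p0; apply/polyP => k.
  rewrite coef_poly coef_derivn coefD coefMX coefC !addSn/= addr0.
  have e : p0`_(j + k) *+ (j + k).+1 ^_ j.+1 = p`_k *+ (k + j).+1.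
    by rewrite /p coef_derivn -mulrnA ffactSS mulnC [(k + j)%N]addnC.
  by rewrite e; case: ltnP => // /(nth_default 0) ->; rewrite mul0rn.
pose x := K *m horner_mx B (derivn j (h %/ ('X - mu%:P))) *m b.
pose G : {poly C} := \sum_(k < N) (p`_k * testf x (D ^+ k)) *: 'X^((k + j).+1).
have dGE (r : R) : (deriv G).[r%:C] = r%:C ^+ j *
    testf x (horner_mx (mu%:M + r%:C *: D) (derivn j.+1 h)).
  rewrite horner_mx_translate hE horner_mx_poly.
  under [X in testf x X]eq_bigr do rewrite exprZn scalerA.
  rewrite testf_sum mulr_sumr linear_sum horner_sum; apply: eq_bigr => k _ /=.
  rewrite derivZ derivXn hornerZ hornerMn hornerXn/= exprD.
  by rewrite -[_ *+ _]mulr_natr -[p`_k *+ _]mulr_natr; ring.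
have GE1 : G.[1] = (S ^+ 2)%:C.
  rewrite /S -testf_self -/x.
  rewrite (_ : B = mu%:M + D); last by rewrite addrC subrK.
  rewrite horner_mx_translate derivn_translate -/p0 -/p pE horner_mx_poly.
  rewrite testf_sum horner_sum; apply: eq_bigr => k _.
  by rewrite hornerZ hornerXn expr1n mulr1.
have GE0 : G.[0] = 0.
  rewrite horner_sum big1// => k _.
  by rewrite hornerZ hornerXn expr0n mulr0.
have := @poly_mean_value G j (S * M); rewrite GE1 GE0 subr0 nc_real.
rewrite ger0_norm ?sqr_ge0// -mulrA expr2 ler_pM2l//; apply.
move=> r /[dup] r01 /andP[r0 _]; rewrite dGE ncM ncX nc_real ger0_norm//.
rewrite mulrC ler_wpM2r ?exprn_ge0//; apply: le_trans (nc_testf _ _) _.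
by rewrite ler_wpM2l ?enorm_ge0//; exact: le.
Qed.

(** One factor is divided off at a time, and the order of differentiation goes
    up by one each time; the factors 1/(j+1), ..., 1/(j + size s) multiply to
    j! / (size s + j)!. The set U has to contain the segments from its matrices
    to the scalar matrices of the roots. *)
Lemma seminorm_divp_prod (U : set 'M[C]_n.+1) (s : seq C) :
  (forall B mu (r : R), U B -> mu \in s -> 0 <= r <= 1 ->
     U (mu%:M + r%:C *: (B - mu%:M))) ->
  forall j (h : {poly C}) (M : R),
  (forall B, U B -> seminorm (horner_mx B (derivn (size s + j) h)) <= M) ->
  forall B, U B ->
  seminorm (horner_mx B (derivn j (h %/ \prod_(mu <- s) ('X - mu%:P)))) <=
    M * j`!%:R / (size s + j)`!%:R.
Proof.
have fact_neq0 k : k`!%:R != 0 :> R by rewrite pnatr_eq0 -lt0n fact_gt0.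
elim: s => [|mu s IH] star j h M le B UB.
  rewrite big_nil divp1 add0n mulfK//; exact: le.
rewrite big_cons -divp_divl.
have le' B' : U B' ->
    seminorm (horner_mx B' (derivn (size s + j) (h %/ ('X - mu%:P)))) <=
    M / (size s + j).+1%:R.
  move=> UB'; apply: seminorm_divp_XsubC => r r01; apply: le.
  by apply: star => //; rewrite inE eqxx.
apply: le_trans (IH _ j _ _ le' B UB) _.
  by move=> B' nu r UB' nus r01; apply: star => //; rewrite inE nus orbT.
rewrite /= addSn factS natrM le_eqVlt; apply/orP; left; apply/eqP.
by rewrite invfM; ring.
Qed.

End Bound.
End DividedDifferences.

(** * Rational Krylov spaces *)

Section RationalKrylov.
Variable R : realType.
Local Notation C := R[i].

Lemma mximageP m n (V : 'M[C]_(m, n)) x :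
  reflect (exists y, x = V *m y) (x \in mximage V).
Proof.
apply: (iffP memv_imgP) => [[y _]|[y ->]]; first by rewrite lfunE; exists y.
by exists y; rewrite ?memvf// lfunE.
Qed.

Lemma dim_mximage m n (V : 'M[C]_(m, n)) (W : 'M[C]_(n, m)) :
  W *m V = 1%:M -> \dim (mximage V) = n.
Proof.
move=> WV; rewrite limg_dim_eq ?dimvf /dim/= ?muln1//.
have /lker0P/eqP-> : injective (linfun (mulmx V : 'cV[C]_n -> 'cV[C]_m)).
  move=> x y; rewrite !lfunE/= => /(congr1 (mulmx W)).
  by rewrite !mulmxA WV !mul1mx.
by rewrite capv0.
Qed.

(** [root_prod] as a polynomial: v and Omega are both of this form. *)
Definition pole_poly m (c : 'I_m -> C) (e : 'I_m -> nat) : {poly C} :=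
  \prod_(k < m) ('X - (c k)%:P) ^+ e k.

Lemma horner_pole_poly m c (e : 'I_m -> nat) :
  root_prod c e = horner (pole_poly c e).
Proof.
apply/funext => z; rewrite /root_prod /pole_poly horner_prod.
by apply: eq_bigr => k _; rewrite horner_exp hornerXsubC.
Qed.

Lemma monic_pole_poly m c (e : 'I_m -> nat) : pole_poly c e \is monic.
Proof. by apply: monic_prod => k _; rewrite monic_exp ?monicXsubC. Qed.

Lemma size_pole_poly m c (e : 'I_m -> nat) :
  size (pole_poly c e) = (\sum_k e k).+1.
Proof.
rewrite size_prod => [|k _]; last by rewrite expf_neq0 ?polyXsubC_eq0.
under eq_bigr do rewrite size_exp_XsubC -addn1.
by rewrite big_split/= sum1_card -addSn addnK.
Qed.

Lemma pole_poly_unit n (B : 'M[C]_n.+1) m c (e : 'I_m -> nat) :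
  (forall k, ~ spectrum B (c k)) -> horner_mx B (pole_poly c e) \in unitmx.
Proof.
move=> nB; rewrite rmorph_prod; apply: (@big_rec _ (fun X => X \in unitmx)).
  exact: unitmx1.
move=> k X _ uX; rewrite rmorphXn/= unitmx_mul uX andbT.
apply: (@GRing.unitrX 'M[C]_n.+1).
rewrite rmorphB/= horner_mx_X horner_mx_C -opprB unitrN.
exact: spectrumPn.
Qed.

Lemma invmx_comm n (X Y : 'M[C]_n) : X \in unitmx -> X *m Y = Y *m X ->
  invmx X *m Y = Y *m invmx X.
Proof.
move=> uX XY; apply: (canRL (mulmxK uX)); rewrite -mulmxA -XY.
by rewrite mulKmx.
Qed.

Variables (n N m : nat) (A : 'M[C]_n.+1) (b : 'cV[C]_n.+1).
Variables (lam : 'I_m -> C) (kap0 : nat) (kap : 'I_m -> nat).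
Variables (V : 'M[C]_(n.+1, N.+1)) (W : 'M[C]_(N.+1, n.+1)).
Hypothesis lamA : forall k, ~ spectrum A (lam k).
Hypothesis WV : W *m V = 1%:M.
Hypothesis Vbasis : basis_of (mximage V) (krylov_vectors A b lam kap0 kap).

Let v := pole_poly lam kap.
Let vA := horner_mx A v.
Let vA_unit : vA \in unitmx. Proof. exact: pole_poly_unit. Qed.

Lemma krylov_size : (kap0 + \sum_k kap k = N.+1)%N.
Proof.
have := size_basis (Vbasis : basis_of _ (in_tuple _)); rewrite (dim_mximage WV) => ->.
rewrite size_cat size_map size_iota size_allpairs_dep; congr (_ + _)%N.
by rewrite sumnE big_map big_enum/=; apply: eq_bigr => k _; rewrite size_iota.
Qed.

(** The value at b of the rational function with numerator q and denominator v,
    taken at the matrix A. *)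
Let rat (q : {poly C}) : 'cV[C]_n.+1 := invmx vA *m horner_mx A q *m b.

(** For the second kind of vectors the pole (z - lam k)^-j is written with the
    denominator v; since j <= kap k the numerator is v divided by a power of
    the factor at lam k, up to a sign. *)
Lemma krylov_rational x : x \in krylov_vectors A b lam kap0 kap ->
  exists2 q : {poly C}, (size q <= N.+1)%N & x = rat q.
Proof.
have ks := krylov_size.
rewrite mem_cat => /orP[/mapP[l]|/allpairsPdep[k [j []]]].
  rewrite mem_iota add0n => /andP[_ l_lt] ->; exists (v * 'X^l).
    rewrite size_monicM ?monic_pole_poly -?size_poly_eq0 ?size_polyXn//.
    rewrite size_pole_poly -ks addSn addnS /=. by rewrite addnC ltn_add2r.
  by rewrite /rat rmorphM rmorphXn/= horner_mx_X -mulmxE mulmxA mulVmx// mul1mx.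
move=> _; rewrite mem_iota add1n ltnS => /andP[j_gt0 j_le] ->.
pose r := ('X - (lam k)%:P) ^+ (kap k - j) *
   \prod_(l < m | l != k) ('X - (lam l)%:P) ^+ kap l.
have vE : v = ('X - (lam k)%:P) ^+ j * r.
  by rewrite /v /pole_poly (bigD1 k)//= /r mulrA -exprD subnKC.
have r_neq0 : r != 0.
  by have := monic_neq0 (monic_pole_poly lam kap); rewrite -/v vE mulf_eq0 => /norP[].
pose q := (-1) ^+ j * r.
have vEq : v = ((lam k)%:P - 'X) ^+ j * q.
  by rewrite vE /q [RHS]mulrA -exprMn mulrN1 opprB.
exists q.
  rewrite size_Msign.
  have := size_pole_poly lam kap; rewrite -/v vE size_monicM ?monic_exp ?monicXsubC//.
  rewrite size_exp_XsubC addSn/= => e.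
  have : (j + size r <= N.+2)%N by rewrite e ltnS -ks leq_addl.
  by move=> le; rewrite -ltnS; apply: leq_trans le; rewrite -add1n leq_add2r.
set Y := (lam k)%:M - A; have uY : Y \in unitmx by exact: spectrumPn.
have vAE : vA = horner_mx A q * Y ^+ j.
  rewrite /vA vEq mulrC rmorphM rmorphXn rmorphB/= horner_mx_X horner_mx_C.
  by [].
rewrite /rat -mulmxA; apply: (canRL (mulKmx vA_unit)).
rewrite vAE -mulmxE -mulmxA; congr (_ *m _); rewrite mulmxA.
have -> : invmx Y ^+ j = (Y ^+ j)^-1 by rewrite -exprVn.
by rewrite mulmxE mulrV ?mul1mx// unitrX.
Qed.

(** The vectors [rat q] with deg q <= N form a space of dimension at most N + 1.
    It contains the basis of the image of V, whose dimension is N + 1, and so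
    it is that image. Comparing dimensions takes the place of a partial fraction
    decomposition. *)
Lemma krylov_space (q : {poly C}) : (size q <= N.+1)%N -> rat q \in mximage V.
Proof.
move=> sq.
pose F : {linear 'rV[C]_N.+1 -> 'cV[C]_n.+1} :=
  mulmxr b \o (mulmx (invmx vA) \o (horner_mx A \o rVpoly)).
pose L : 'Hom('rV[C]_N.+1, 'cV[C]_n.+1) := linfun F.
have LE c : L c = rat (rVpoly c) by rewrite lfunE.
have ratF (p : {poly C}) : (size p <= N.+1)%N -> rat p \in limg L.
  move=> sp; apply/memv_imgP; exists (poly_rV p); rewrite ?memvf//.
  by rewrite LE poly_rV_K.
suff /eqP-> : mximage V == limg L by exact: ratF.
rewrite eqEdim; apply/andP; split.
  have /andP[/eqP <- _] := Vbasis; apply/span_subvP => x /krylov_rational[p sp ->].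
  exact: ratF.
rewrite (dim_mximage WV); have := limg_ker_dim L fullv.
by rewrite dimvf /dim/= mul1n => dimL; rewrite -[leqRHS]dimL leq_addl.
Qed.

Let u := invmx vA *m b.

Let ratE q : rat q = horner_mx A q *m u.
Proof.
rewrite /rat /u mulmxA; congr (_ *m _); apply: invmx_comm vA_unit _.
exact: comm_horner_mx2.
Qed.

Variable Ah : 'M[C]_N.+1.
Hypothesis AhE : Ah = W *m A *m V.

(** Induction on the degree: as long as A^l u lies in the image of V, where
    V W is the identity, one more factor A turns into a factor W A V. For the
    last step only the vector before it has to lie in the image, hence the
    degree N + 1, one more than the numerators of [krylov_space]. *)
Lemma krylov_projection (q : {poly C}) : (size q <= N.+2)%N ->
  W *m (horner_mx A q *m u) = horner_mx Ah q *m (W *m u).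
Proof.
move=> sq; have VW x : x \in mximage V -> V *m (W *m x) = x.
  by move=> /mximageP[y ->]; rewrite (mulmxA W) WV mul1mx.
have powers l : (l <= N.+1)%N -> W *m (A ^+ l *m u) = Ah ^+ l *m (W *m u).
  elim: l => [_|l IH lN]; first by rewrite !expr0 !mul1mx.
  rewrite !exprS -!mulmxE -!mulmxA -IH ?(ltnW lN)// AhE -!mulmxA VW//.
  have -> : A ^+ l *m u = rat 'X^l by rewrite ratE rmorphXn/= horner_mx_X.
  by apply: krylov_space; rewrite size_polyXn.
have qE : q = \poly_(l < N.+2) q`_l.
  apply/polyP => l; rewrite coef_poly; case: ltnP => // le.
  by rewrite nth_default// (leq_trans sq).
rewrite qE !horner_mx_poly !mulmx_suml mulmx_sumr; apply: eq_bigr => l _.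
by rewrite -!scalemxAl -scalemxAr powers// -ltnS.
Qed.

(** The degree of v is at most N + 1, so [krylov_projection] applies to v as
    well: W b = W v(A) u = v(Ah) W u. This is where the denominator passes from
    A to Ah. *)
Lemma krylov_exact (q : {poly C}) : horner_mx Ah v \in unitmx ->
  (size q <= N.+1)%N ->
  V *m (horner_mx Ah q *m (invmx (horner_mx Ah v) *m (W *m b))) =
  horner_mx A q *m (invmx vA *m b).
Proof.
move=> uAh sq.
have sv : (size v <= N.+2)%N by rewrite size_pole_poly ltnS -krylov_size leq_addl.
have := krylov_projection sv; rewrite -/vA {1}/u mulKVmx// => ->.
rewrite mulKmx// -krylov_projection ?(leq_trans sq)//.
have /mximageP[y] := krylov_space sq; rewrite ratE -/u => ->.
by rewrite (mulmxA W) WV mul1mx.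
Qed.

End RationalKrylov.

(** * Continuity and compactness *)

Section MaximumAttained.
Variable R : realType.
Local Notation C := R[i].
Local Notation nc := (@Normc.normc R).

Section Continuity.
Variable T : topologicalType.

Lemma ccontinuous_nc (f : T -> C) : ccontinuous f -> continuous (fun x => nc (f x)).
Proof.
move=> [f1 f2] x.
have ncE y : nc (f y) = Num.sqrt (complex.Re (f y) ^+ 2 + complex.Im (f y) ^+ 2).
  by case: (f y).
under eq_fun do rewrite ncE.
apply: (@continuous_comp _ _ _ (fun y => complex.Re (f y) ^+ 2 + complex.Im (f y) ^+ 2)).
  by apply: cvgD; apply: cvgM; [exact: f1|exact: f1|exact: f2|exact: f2].
exact: sqrt_continuous.
Qed.

Lemma continuous_sumr (I : Type) (s : seq I) (f : I -> T -> R) :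
  (forall i, continuous (f i)) -> continuous (fun x => \sum_(i <- s) f i x).
Proof.
move=> cf x; elim: s => [|i s IH].
  by under eq_fun do rewrite big_nil; exact: cvg_cst.
under eq_fun do rewrite big_cons.
by apply: cvgD; [exact: cf|exact: IH].
Qed.

Lemma ccontinuous_enorm n (f : T -> 'cV[C]_n) :
  (forall i j, ccontinuous (fun x => f x i j)) -> continuous (fun x => enorm (f x)).
Proof.
move=> cf x; apply: (@continuous_comp _ _ _ (fun y => \sum_i nc (f y i 0) ^+ 2)).
  apply: continuous_sumr => i y.
  by apply: cvgM; exact: ccontinuous_nc.
exact: sqrt_continuous.
Qed.

Lemma ccontinuous_mnorm m n (f : T -> 'M[C]_(m, n)) :
  (forall i j, ccontinuous (fun x => f x i j)) -> continuous (fun x => mnorm (f x)).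
Proof.
move=> cf; apply: continuous_sumr => i; apply: continuous_sumr => j.
exact: ccontinuous_nc.
Qed.

Lemma ccontinuous_mulmx m n p (f : T -> 'M[C]_(m, n)) (g : T -> 'M[C]_(n, p)) :
  (forall i j, ccontinuous (fun x => f x i j)) ->
  (forall i j, ccontinuous (fun x => g x i j)) ->
  forall i j, ccontinuous (fun x => (f x *m g x) i j).
Proof.
move=> cf cg i j; under eq_fun do rewrite mxE.
by apply: ccontinuous_sum => k; apply: ccontinuousM.
Qed.

Lemma ccontinuous_horner_mx n (f : T -> 'M[C]_n.+1) (p : {poly C}) :
  (forall i j, ccontinuous (fun x => f x i j)) ->
  forall i j, ccontinuous (fun x => horner_mx (f x) p i j).
Proof.
move=> cf i j.
have cX k : forall i j, ccontinuous (fun x => (f x ^+ k) i j).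
  elim: k => [|k IH] i' j'.
    by under eq_fun do rewrite expr0; exact: ccontinuous_cst.
  by under eq_fun do rewrite exprS -mulmxE; exact: ccontinuous_mulmx.
rewrite -(coefK p); under eq_fun do rewrite horner_mx_poly summxE.
apply: ccontinuous_sum => k; under eq_fun do rewrite mxE.
exact: ccontinuousZ.
Qed.

Lemma seminorm_dist n q (K : 'M[C]_(q, n.+1)) (b : 'cV[C]_n.+1) X Y :
  `|seminorm K b X - seminorm K b Y| <= mnorm K * mnorm (X - Y) * mnorm b.
Proof.
apply: le_trans (enorm_dist _ _) _; rewrite -mulmxBl -mulmxBr.
apply: le_trans (enorm_le_mnorm _) _; apply: le_trans (mnormM _ _) _.
by rewrite ler_wpM2r ?mnorm_ge0// mnormM.
Qed.

(** Near each point the function is a uniform limit of the continuous functions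
    that belong to the approximating polynomials. *)
Lemma continuous_seminorm_matfun n q (K : 'M[C]_(q, n.+1)) (b : 'cV[C]_n.+1)
    (P : nat -> {poly C}) (F : C -> C) (f : T -> 'M[C]_n.+1) :
  approximates P F -> preserves_ccontinuous F ->
  (forall i j, ccontinuous (fun x => f x i j)) ->
  continuous (fun x => seminorm K b (matfun F (f x))).
Proof.
move=> PF cF cf x; apply/cvgrPdist_le => e e0.
pose k := mnorm K * mnorm b + 1.
have k0 : 0 < k by rewrite ltr_wpDl// mulr_ge0 ?mnorm_ge0.
have ek : 0 < e / 3 / k by rewrite !divr_gt0.
have [N0 le] := matfun_approximates n (mnorm (f x) + 1) PF cF ek.
have {}le y : mnorm (f y) <= mnorm (f x) + 1 ->
    `|seminorm K b (matfun F (f y)) - seminorm K b (horner_mx (f y) (P N0))| <= e / 3.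
  move=> /(le _ (leqnn _)) le1; apply: le_trans (seminorm_dist _ _ _ _) _.
  rewrite mulrAC; apply: le_trans (ler_wpM2l _ le1) _.
    by rewrite mulr_ge0 ?mnorm_ge0.
  by rewrite mulrC -[leRHS](divfK (lt0r_neq0 k0)) ler_wpM2l ?(ltW ek)// /k lerDl.
have cP : continuous (fun y => seminorm K b (horner_mx (f y) (P N0))).
  apply: ccontinuous_enorm; apply: ccontinuous_mulmx => [|i j]; last exact: ccontinuous_cst.
  apply: ccontinuous_mulmx => [i j|]; first exact: ccontinuous_cst.
  exact: ccontinuous_horner_mx.
near=> y.
have fy : mnorm (f y) <= mnorm (f x) + 1.
  near: y; have /cvgr_le : mnorm (f y) @[y --> x] --> mnorm (f x).
    exact: (ccontinuous_mnorm cf).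
  by apply; rewrite ltrDl.
have Py : `|seminorm K b (horner_mx (f x) (P N0)) -
    seminorm K b (horner_mx (f y) (P N0))| <= e / 3.
  by near: y; have /cvgrPdist_le := cP x; apply; rewrite divr_gt0.
have fx : mnorm (f x) <= mnorm (f x) + 1 by rewrite lerDl.
have lx := le x fx; have ly := le y fy; rewrite distrC in ly.
move: lx ly Py.
move: (seminorm K b (matfun F (f x))) (seminorm K b (matfun F (f y))).
move: (seminorm K b (horner_mx (f x) (P N0))) (seminorm K b (horner_mx (f y) (P N0))).
move=> a' d' a d lx ly Py.
have -> : e = e / 3 + e / 3 + e / 3 by field.
have -> : a - d = (a - a') + (a' - d') + (d' - d) by ring.
apply: le_trans (ler_normD _ _) _; apply: lerD ly.
by apply: le_trans (ler_normD _ _) _; apply: lerD.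
Unshelve. all: by end_near.
Qed.

End Continuity.

(** In the hull of finitely many points the number of terms of a convex
    combination can be fixed, by collecting the weights of equal points; this
    makes the hull the image of a simplex. *)
Lemma convex_hull_rangeP m (mu : 'I_m -> C) z :
  convex_hull (range mu) z <->
  exists a : 'I_m -> R, [/\ forall k, 0 <= a k, \sum_k a k = 1 &
    z = \sum_k (a k)%:C * mu k].
Proof.
split=> [[k [a [x [a0 a1 xM ->]]]]|[a [a0 a1 ->]]]; last first.
  by exists m, a, mu; split=> // k; exists k.
have /choice[g gx] : forall l, exists j, mu j = x l.
  by move=> l; have [j _ <-] := xM l; exists j.
exists (fun j => \sum_(l | g l == j) a l); split.
- by move=> j; apply: sumr_ge0.
- by rewrite -a1 [RHS](partition_big g predT).
- rewrite (partition_big g predT)//; apply: eq_bigr => j _.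
  rewrite rmorph_sum mulr_suml; apply: eq_bigr => l /eqP <-.
  by rewrite gx.
Qed.

(** The pairs (s, a), with a in the simplex of barycentric coordinates, form a
    closed subset of a cube. *)
Lemma max_attained m (mu : 'I_m -> C) (S : R -> C -> R) : (0 < m)%N ->
  continuous (fun x : 'rV[R]_(1 + m) =>
    S (x 0 (lshift m 0)) (\sum_k (x 0 (rshift 1 k))%:C * mu k)) ->
  exists M, is_max [set S s z | s in `[0%R, 1%R] & z in convex_hull (range mu)] M.
Proof.
move=> m0 cS.
pose sumT (x : 'rV[R]_(1 + m)) := \sum_k x 0 (rshift 1 k).
pose D := [set x : 'rV[R]_(1 + m) | (forall i, 0 <= x 0 i <= 1)] `&`
  [set x | sumT x = 1].
have cD : compact D.
  apply: compact_closedI.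
    have cI := @rV_compact R (1 + m) (fun=> `[0%R, 1%R]%classic)
      (fun=> @segment_compact R 0 1).
    suff -> : [set x : 'rV[R]_(1 + m) | forall i, 0 <= x 0 i <= 1] =
      [set x : 'rV[R]_(1 + m) | forall i, `[0%R, 1%R]%classic (x ord0 i)] by exact: cI.
    by apply/seteqP; split=> x /= x01 i; have := x01 i; rewrite /= in_itv.
  rewrite (_ : [set x | _] = sumT @^-1` [set 1])//.
  apply: closed_comp; last exact: closed_eq.
  move=> x _; apply: continuous_sumr => k y; exact: coord_continuous.
pose mk s (a : 'I_m -> R) : 'rV[R]_(1 + m) := row_mx (\row_(i < 1) s) (\row_k a k).
have mk0 s a : mk s a 0 (lshift m 0) = s by rewrite row_mxEl mxE.
have mk1 s a k : mk s a 0 (rshift 1 k) = a k by rewrite row_mxEr mxE.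
have Dmk s a : 0 <= s <= 1 -> (forall k, 0 <= a k) -> \sum_k a k = 1 -> D (mk s a).
  move=> s01 a0 a1; split.
    move=> i; rewrite /mk -(splitK i); case: (fintype.split i) => j /=.
      by rewrite row_mxEl mxE.
    rewrite row_mxEr mxE a0/= -a1 (bigD1 j)//= lerDl.
    exact: sumr_ge0.
  by rewrite /= /sumT; under eq_bigr do rewrite mk1.
have D0 : D !=set0.
  exists (mk 0 (fun k => (k == Ordinal m0)%:R)); apply: Dmk; rewrite ?lexx ?ler01//.
  by rewrite (bigD1 (Ordinal m0))// eqxx big1 => [|k /negPf->//]; exact: addr0.
have [x xD xmax] := EVT_max_rV D0 cD (continuous_subspaceT cS).
have {xD}[x01 x1] := set_mem xD.
exists (S (x 0 (lshift m 0)) (\sum_k (x 0 (rshift 1 k))%:C * mu k)); split.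
  exists (x 0 (lshift m 0)); first by rewrite /= in_itv/= x01.
  exists (\sum_k (x 0 (rshift 1 k))%:C * mu k) => //.
  apply/convex_hull_rangeP; exists (fun k => x 0 (rshift 1 k)); split=> //.
  by move=> k; have /andP[] := x01 (rshift 1 k).
move=> _ [s s01 [z /convex_hull_rangeP[a [a0 a1 ->]] <-]].
rewrite /= in_itv/= in s01.
have := xmax _ (mem_set (Dmk s a s01 a0 a1)).
by rewrite mk0; under eq_bigr do rewrite mk1.
Qed.

End MaximumAttained.

(** * Roots, convex hulls and the segments from hull points to a matrix *)

Section ErrorBound.
Variable R : realType.
Local Notation C := R[i].
Local Notation nc := (@Normc.normc R).

Lemma prod_XsubC_mup m (mu : 'I_m -> C) (s : seq C) : injective mu ->
  (forall z, z \in s -> range mu z) ->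
  \prod_(z <- s) ('X - z%:P) =
    pole_poly mu (fun k => mup (mu k) (\prod_(z <- s) ('X - z%:P))).
Proof.
move=> mu_inj; elim: s => [|z s IH] sP.
  rewrite big_nil /pole_poly big1// => k _.
  by rewrite mupNroot ?expr0// root1.
have [|j _ jz] := sP z; first by rewrite inE eqxx.
have prod_neq0 : \prod_(z <- s) ('X - z%:P) != 0 :> {poly C}.
  exact/monic_neq0/monic_prod_XsubC.
rewrite big_cons {1}IH => [|w ws]; last by apply: sP; rewrite inE ws orbT.
have e k : mup (mu k) (('X - z%:P) * \prod_(j <- s) ('X - j%:P)) =
    ((j == k) + mup (mu k) (\prod_(j <- s) ('X - j%:P)))%N.
  rewrite mupM ?polyXsubC_eq0// -['X - z%:P]expr1 mup_XsubCX -jz.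
  by rewrite (inj_eq mu_inj); case: (j == k).
rewrite [RHS]/pole_poly; under [RHS]eq_bigr do rewrite e exprD.
rewrite big_split/=; congr (_ * _).
rewrite (bigD1 j)//= eqxx expr1 jz big1 ?mulr1// => k /negPf.
by rewrite eq_sym => ->.
Qed.

Lemma char_poly_split n (B : 'M[C]_n) m (mu : 'I_m -> C) (w : 'I_m -> nat) :
  injective mu -> spectrum B = range mu ->
  (forall k, w k = mup (mu k) (char_poly B)) ->
  exists s : seq C, [/\ forall z, z \in s -> range mu z,
    char_poly B = \prod_(z <- s) ('X - z%:P) & pole_poly mu w = char_poly B].
Proof.
move=> mu_inj specB wE; have [s] := closed_field_poly_normal (char_poly B).
rewrite (eqP (char_poly_monic B)) scale1r => sE.
have sP z : z \in s -> range mu z.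
  move=> zs; rewrite -specB /spectrum/= eigenvalue_root_char sE.
  by rewrite root_prod_XsubC.
exists s; split=> //; rewrite [RHS]sE (prod_XsubC_mup mu_inj sP).
by congr pole_poly; apply/funext => k; rewrite wE sE.
Qed.

Lemma convex_hull_combine (m : nat) (mu : 'I_m -> C) (x y : C) (al be : R) :
  convex_hull (range mu) x -> convex_hull (range mu) y ->
  0 <= al -> 0 <= be -> al + be = 1 ->
  convex_hull (range mu) (al%:C * x + be%:C * y).
Proof.
move=> /convex_hull_rangeP[a [a0 a1 ->]] /convex_hull_rangeP[c [c0 c1 ->]] al0 be0 e.
apply/convex_hull_rangeP; exists (fun k => al * a k + be * c k); split.
- by move=> k; rewrite addr_ge0 ?mulr_ge0.
- by rewrite big_split/= -!mulr_sumr a1 c1 !mulr1.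
- rewrite !mulr_sumr -big_split/=; apply: eq_bigr => k _.
  by rewrite rmorphD !rmorphM/= mulrDl !mulrA.
Qed.

Lemma convex_hull_gen (m : nat) (mu : 'I_m -> C) k : convex_hull (range mu) (mu k).
Proof.
apply/convex_hull_rangeP; exists (fun j => (j == k)%:R); split.
- by move=> j; case: eqP.
- by rewrite (bigD1 k)//= eqxx big1 ?addr0// => j /negPf ->.
- rewrite (bigD1 k)//= eqxx mul1r big1 ?addr0// => j /negPf ->.
  by rewrite mul0r.
Qed.

Definition segment_matrix n (A : 'M[C]_n) (s : R) (z : C) : 'M[C]_n :=
  ((1 - s)%:C * z)%:M + s%:C *: A.

Definition segment_set n (A : 'M[C]_n) (M : set C) : set 'M[C]_n :=
  [set segment_matrix A s z | s in `[0%R, 1%R] & z in M].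

(** The new point has the parameter r s, and its hull point is the combination
    of mu k and z with the weights (1 - r) / (1 - r s) and
    r (1 - s) / (1 - r s). For r s = 1 these are undefined, but then r = s = 1
    and the hull point does not enter. *)
Lemma segment_set_star n (A : 'M[C]_n) m (mu : 'I_m -> C) B k (r : R) :
  segment_set A (convex_hull (range mu)) B -> 0 <= r <= 1 ->
  segment_set A (convex_hull (range mu))
    ((mu k)%:M + r%:C *: (B - (mu k)%:M)).
Proof.
move=> [s s01 [z Mz <-]] /andP[r0 r1]; rewrite /= in_itv/= in s01.
have /andP[s0 s1] := s01.
have rs01 : 0 <= r * s <= 1 by rewrite mulr_ge0//= mulr_ile1.
exists (r * s); first by rewrite /= in_itv.
have combo z' : (1 - r * s)%:C * z' = (1 - r)%:C * mu k + (r * (1 - s))%:C * z ->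
    segment_matrix A (r * s) z' =
    (mu k)%:M + r%:C *: (segment_matrix A s z - (mu k)%:M).
  rewrite /segment_matrix => ->; apply/matrixP => p q; rewrite !mxE.
  by case: (p == q); rewrite ?mulr1n ?mulr0n !(rmorphM, rmorphB, rmorph1)/=; ring.
have [e|ne] := eqVneq (r * s) 1.
  have r_eq1 : r = 1.
    apply/eqP; rewrite eq_le r1 -e; rewrite -[leRHS]mulr1; exact: ler_wpM2l.
  have s_eq1 : s = 1 by rewrite r_eq1 mul1r in e.
  exists z => //; apply: combo; rewrite r_eq1 s_eq1 mulr1 subrr mulr0.
  by rewrite !mul0r addr0.
have d0 : 0 < 1 - r * s.
  by rewrite subr_gt0 lt_neqAle ne; case/andP: rs01.
exists ((((1 - r) / (1 - r * s))%:C * mu k) + ((r * (1 - s)) / (1 - r * s))%:C * z).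
  apply: convex_hull_combine => //.
  - exact: convex_hull_gen.
  - by rewrite divr_ge0 ?subr_ge0// ltW// -subr_gt0.
  - by rewrite divr_ge0 ?mulr_ge0 ?subr_ge0// ltW// -subr_gt0.
  - by field; rewrite lt0r_neq0.
apply: combo; rewrite mulrDr !mulrA -!rmorphM/=.
by congr (_%:C * _ + _%:C * _); field; rewrite lt0r_neq0.
Qed.

Lemma convex_hull_bounded m (mu : 'I_m -> C) z :
  convex_hull (range mu) z -> nc z <= \sum_k nc (mu k).
Proof.
move=> /convex_hull_rangeP[a [a0 a1 ->]]; apply: le_trans (nc_sum _ _ _) _.
apply: ler_sum => k _; rewrite ncM nc_real ger0_norm// ler_piMl ?nc_ge0//.
rewrite -a1 (bigD1 k)//= lerDl; exact: sumr_ge0.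
Qed.

Lemma segment_set_bounded n (A : 'M[C]_n) m (mu : 'I_m -> C) B :
  segment_set A (convex_hull (range mu)) B ->
  mnorm B <= (n * n)%:R * (\sum_k nc (mu k)) + mnorm A.
Proof.
move=> [s s01 [z Mz <-]]; rewrite /= in_itv/= in s01; have /andP[s0 s1] := s01.
apply: le_trans (mnormD _ _) _; apply: lerD.
  apply: mnorm_le => i j; rewrite !mxE.
  case: (i == j); rewrite ?mulr1n ?mulr0n ?nc0; last first.
    by apply: sumr_ge0 => k _; exact: nc_ge0.
  rewrite ncM nc_real ger0_norm ?subr_ge0//.
  apply: le_trans (convex_hull_bounded Mz); rewrite ler_piMl ?nc_ge0//.
  by rewrite gerBl.
by rewrite mnormZ nc_real ger0_norm// ler_piMl ?mnorm_ge0.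
Qed.

End ErrorBound.

(** * The error of the reduced-order approximation *)

Section ErrorEstimate.
Variable R : realType.
Local Notation C := R[i].
Local Notation nc := (@Normc.normc R).

Lemma horner_mx_modp n (B : 'M[C]_n.+1) (p : {poly C}) :
  horner_mx B (p %% char_poly B) = horner_mx B p.
Proof.
rewrite [in RHS](divp_eq p (char_poly B)) rmorphD rmorphM/=.
by rewrite Cayley_Hamilton mulr0 add0r.
Qed.

Variables (n N m : nat) (A : 'M[C]_n.+1) (b : 'cV[C]_n.+1).
Variables (lam : 'I_m -> C) (kap0 : nat) (kap : 'I_m -> nat).
Variables (V : 'M[C]_(n.+1, N.+1)) (W : 'M[C]_(N.+1, n.+1)).
Variable Ah : 'M[C]_N.+1.
Hypothesis lamA : forall k, ~ spectrum A (lam k).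
Hypothesis lamAh : forall k, ~ spectrum Ah (lam k).
Hypothesis WV : W *m V = 1%:M.
Hypothesis Vbasis : basis_of (mximage V) (krylov_vectors A b lam kap0 kap).
Hypothesis AhE : Ah = W *m A *m V.

Local Notation v := (pole_poly lam kap).
Local Notation K := (horner_mx A (char_poly Ah) *m invmx (horner_mx A v)).

(** Modulo the characteristic polynomial of Ah the polynomial v p has a remainder
    q of degree at most N. It does not change v p at Ah, and on q the projection
    is exact; so only the part of v p divisible by the characteristic polynomial
    contributes to the error. *)
Lemma polynomial_error (p : {poly C}) :
  horner_mx A p *m b - V *m (horner_mx Ah p *m (W *m b)) =
  K *m horner_mx A ((v * p) %/ char_poly Ah) *m b.
Proof.
have vA := pole_poly_unit kap lamA; have vAh := pole_poly_unit kap lamAh.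
set q := (v * p) %% char_poly Ah; set d := _ %/ _.
have vpE : v * p = d * char_poly Ah + q := divp_eq _ _.
have sq : (size q <= N.+1)%N.
  by rewrite -ltnS -(size_char_poly Ah) ltn_modp monic_neq0 ?char_poly_monic.
have -> : horner_mx Ah p = horner_mx Ah q *m invmx (horner_mx Ah v).
  rewrite /q horner_mx_modp mulrC rmorphM/= -mulmxE.
  by rewrite mulmxK.
rewrite -mulmxA (krylov_exact lamA WV Vbasis AhE)//.
have -> : horner_mx A p = invmx (horner_mx A v) *m horner_mx A (v * p).
  by rewrite rmorphM/= -mulmxE mulKmx.
have comm r : horner_mx A r *m invmx (horner_mx A v) =
    invmx (horner_mx A v) *m horner_mx A r.
  by rewrite invmx_comm//; exact: comm_horner_mx2.
rewrite (mulmxA (horner_mx A q)) comm vpE rmorphD rmorphM/= mulmxDr mulmxDl addrK.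
rewrite comm -!mulmxA; congr (_ *m _); rewrite !mulmxA; congr (_ *m _).
exact: comm_horner_mx2.
Qed.

Variables (mh : nat) (mu : 'I_mh -> C) (wh : 'I_mh -> nat).
Hypothesis mu_inj : injective mu.
Hypothesis mu_spectrum : spectrum Ah = range mu.
Hypothesis whE : forall k, wh k = mup (mu k) (char_poly Ah).

Lemma mh_gt0 : (0 < mh)%N.
Proof.
have [s [sP sE _]] := char_poly_split mu_inj mu_spectrum whE.
case: s sP sE => [|z s] sP sE.
  by have := size_char_poly Ah; rewrite sE big_nil size_poly1.
have [|k _ _] := sP z; first by rewrite inE eqxx.
by case: (mh) k => // -[].
Qed.

Variable t : R.
Let G : C -> C := fun z => (iter N.+1 (dexp t) v).[z] * exp_t t z.
Let c : C := (N.+1)`!%:R^-1.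
Let hull := convex_hull (range mu).

Lemma error_max : exists M : R, is_max
  [set seminorm (c *: K) b (matfun G (segment_matrix A s z))
    | s in `[0%R, 1%R] & z in hull] M.
Proof.
apply: (@max_attained _ _ mu
  (fun s z => seminorm (c *: K) b (matfun G (segment_matrix A s z))) mh_gt0).
apply: continuous_seminorm_matfun.
- exact: (approximates_derivn _ _ (leqnn N.+1)).
- exact: preserves_poly_exp_t.
have cx l : ccontinuous (fun x : 'rV[R]_(1 + mh) => (x 0 l)%:C).
  by apply: ccontinuous_real; exact: coord_continuous.
move=> i j; under eq_fun do rewrite !mxE -mulr_natr rmorphB rmorph1 -mulN1r.
apply: ccontinuousD; apply: ccontinuousM; try exact: ccontinuous_cst; last exact: cx.
apply: ccontinuousM.
  by apply: ccontinuousD; [exact: ccontinuous_cst|apply: ccontinuousZ; exact: cx].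
apply: ccontinuous_sum => k; apply: ccontinuousM; [exact: cx|exact: ccontinuous_cst].
Qed.

(** For the Taylor polynomials in place of exp_t the error is given by
    [polynomial_error] and bounded by [seminorm_divp_prod] on the set of all
    (1 - s) z + s A, which contains A itself (s = 1). The derivatives involved
    there, of order nh, converge uniformly on this set, so in the limit the
    bound is M up to an arbitrary e'. *)
Lemma error_le_max (M : R) :
  (forall s z, 0 <= s <= 1 -> hull z ->
    seminorm (c *: K) b (matfun G (segment_matrix A s z)) <= M) ->
  enorm (matfun (exp_t t) A *m b - V *m (matfun (exp_t t) Ah *m (W *m b))) <= M.
Proof.
move=> leM; have [s [sP sE _]] := char_poly_split mu_inj mu_spectrum whE.
pose E k := taylor_exp t (k + N.+1).
pose P k := derivn N.+1 (v * E k).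
pose U := segment_set A hull.
have PG : approximates P G := approximates_derivn t v (leqnn N.+1).
have cG : preserves_ccontinuous G by exact: preserves_poly_exp_t.
have EE : approximates E (exp_t t) := approximates_taylor_exp t N.+1.
(* The sum of the constants in front of e in the three approximation errors;
   the summand 1 only makes it positive. *)
pose k0 := mnorm (c *: K) * mnorm b + mnorm b + mnorm V * (mnorm W * mnorm b) + 1.
have bV0 : 0 <= mnorm V * (mnorm W * mnorm b) by rewrite !mulr_ge0 ?mnorm_ge0.
have cK0 : 0 <= mnorm (c *: K) * mnorm b by rewrite mulr_ge0 ?mnorm_ge0.
have k0_gt0 : 0 < k0 by rewrite ltr_wpDl// !addr_ge0 ?mnorm_ge0.
apply/ler_addgt0Pr => e' e'0; pose e := e' / k0.
have e0 : 0 < e by rewrite divr_gt0.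
have [N1 le1] := matfun_approximates n
  ((n.+1 * n.+1)%:R * (\sum_k nc (mu k)) + mnorm A) PG cG e0.
have [N2 le2] := matfun_approximates n (mnorm A) EE (preserves_exp_t t) e0.
have [N3 le3] := matfun_approximates N (mnorm Ah) EE (preserves_exp_t t) e0.
pose k := maxn N1 (maxn N2 N3).
have {}le1 := le1 k (leq_maxl _ _).
have {}le2 := le2 k (leq_trans (leq_maxl N2 N3) (leq_maxr _ _)) A (lexx _).
have {}le3 := le3 k (leq_trans (leq_maxr N2 N3) (leq_maxr _ _)) Ah (lexx _).
have fact_gt0 : 0 < (N.+1)`!%:R :> R by rewrite ltr0n fact_gt0.
have cKE X : seminorm K b X = (N.+1)`!%:R * seminorm (c *: K) b X.
  rewrite /seminorm -!scalemxAl enormZ /c Normc.normcV nc_nat.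
  by rewrite mulVKf// lt0r_neq0.
have leU B : U B -> seminorm K b (horner_mx B (derivn (size s + 0) (v * E k))) <=
    (N.+1)`!%:R * (M + mnorm (c *: K) * e * mnorm b).
  have -> : (size s + 0 = N.+1)%N.
    rewrite addn0; apply/eqP; rewrite -eqSS -(size_char_poly Ah) sE.
    by rewrite size_prod_XsubC.
  move=> UB; rewrite cKE ler_pM2l// -lerBlDl.
  have leMB : seminorm (c *: K) b (matfun G B) <= M.
    by case: UB => r r01 [z hz <-]; apply: leM => //; rewrite /= in_itv in r01.
  apply: le_trans (lerB (lexx _) leMB) _; apply: le_trans (ler_norm _) _.
  rewrite distrC; apply: le_trans (seminorm_dist _ _ _ _) _.
  rewrite ler_wpM2r ?mnorm_ge0// ler_wpM2l ?mnorm_ge0//.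
  exact/le1/segment_set_bounded.
have star B z (r : R) : U B -> z \in s -> 0 <= r <= 1 ->
    U (z%:M + r%:C *: (B - z%:M)).
  by move=> UB zs r01; have [j _ <-] := sP z zs; exact: segment_set_star.
have UA : U A.
  exists 1; first by rewrite /= in_itv/= ler01 lexx.
  exists (mu (Ordinal mh_gt0)); first exact: convex_hull_gen.
  by rewrite /segment_matrix subrr mul0r raddf0 add0r scale1r.
have := seminorm_divp_prod star leU UA; rewrite -sE addn0 fact0 mulr1 derivn0.
have -> : size s = N.+1.
  by apply/eqP; rewrite -eqSS -(size_char_poly Ah) sE size_prod_XsubC.
rewrite mulrAC mulfV ?lt0r_neq0// mul1r /seminorm -polynomial_error => le4.
set X := _ - _; set Y := _ - _ in le4.
have -> : X = Y + (X - Y) by rewrite addrC subrK.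
apply: le_trans (enormD _ _) _.
have -> : M + e' = (M + mnorm (c *: K) * e * mnorm b) +
    e * (mnorm b + mnorm V * (mnorm W * mnorm b) + 1).
  rewrite -[e'](divfK (lt0r_neq0 k0_gt0)) -/e /k0; ring.
apply: lerD le4 _; apply: le_trans (enorm_le_mnorm _) _.
have -> : X - Y = (matfun (exp_t t) A - horner_mx A (E k)) *m b -
    V *m ((matfun (exp_t t) Ah - horner_mx Ah (E k)) *m (W *m b)).
  by rewrite !mulmxBl mulmxBr /X /Y [in LHS]opprD addrACA -opprD.
apply: le_trans (mnormD _ _) _; rewrite mnormN !mulrDr mulr1 -addrA lerD//.
  by apply: le_trans (mnormM _ _) _; rewrite ler_wpM2r ?mnorm_ge0.
apply: (@le_trans _ _ (e * (mnorm V * (mnorm W * mnorm b)))); last first.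
  by rewrite lerDl ltW.
rewrite mulrCA; apply: le_trans (mnormM _ _) _; rewrite ler_wpM2l ?mnorm_ge0//.
apply: le_trans (mnormM _ _) _.
apply: ler_pM; rewrite ?mnorm_ge0//; exact: mnormM.
Qed.

End ErrorEstimate.

Lemma eq_image2r (S T U : Type) (X : set S) (Y : set T) (f g : S -> T -> U) :
  (forall s z, f s z = g s z) ->
  [set f s z | s in X & z in Y] = [set g s z | s in X & z in Y].
Proof. by move=> fg; congr image2; apply/funext => s; apply/funext. Qed.

Unset Implicit Arguments.

Theorem theorem24 (R : realType) (n nh m mh : nat) (nh_gt0 : (0 < nh)%N)
  (A : 'M[R[i]]_n) (b : 'cV[R[i]]_n)
  (lam : 'I_m -> R[i]) (kap0 : nat) (kap : 'I_m -> nat)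
  (lam_spectrumA : forall k, ~ spectrum A (lam k))
  (V : 'M[R[i]]_(n, nh))
  (V_isometry : V ^t* *m V = 1%:M)
  (V_basis : basis_of (mximage V) (krylov_vectors A b lam kap0 kap))
  (Ah : 'M[R[i]]_nh) (AhE : Ah = V ^t* *m A *m V)
  (bh : 'cV[R[i]]_nh) (bhE : bh = V ^t* *m b)
  (muh : 'I_mh -> R[i]) (wh : 'I_mh -> nat)
  (muh_inj : injective muh)
  (muhE : spectrum Ah = range muh)
  (whE : forall k, wh k = mup (muh k) (char_poly Ah))
  (lam_spectrumAh : forall k, ~ spectrum Ah (lam k))
  (t : R) :
  let v := root_prod lam kap in
  let Omega := root_prod muh wh in
  exists2 M : R,
    is_max
      [set enorm
             (matfun Omega A *m invmx (matfun v A) *m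
              ((nh`!%:R)^-1 *:
               matfun (cderiven nh (fun z => v z * exp_t t z))
                 (((1 - s)%:C * mu)%:M + s%:C *: A)) *m b)
       | s in `[0%R, 1%R] & mu in convex_hull (range muh)] M
    & enorm (matfun (exp_t t) A *m b - V *m matfun (exp_t t) Ah *m bh) <= M.
Proof.
move=> v Omega.
case: nh nh_gt0 V V_isometry V_basis Ah AhE bh bhE muhE whE lam_spectrumAh
  => [//|nh] _ V V_isometry V_basis Ah AhE bh bhE muhE whE lam_spectrumAh.
case: n A b lam_spectrumA V V_isometry V_basis AhE bhE
  => [|n] A b lam_spectrumA V V_isometry V_basis AhE bhE.
  (* A matrix V without rows cannot be an isometry, as nh > 0. *)
  have /matrixP/(_ 0 0) := V_isometry; rewrite !mxE big_ord0 eqxx => /eqP.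
  by rewrite eq_sym oner_eq0.
have [_ [_ _ wE]] := char_poly_split muh_inj muhE whE.
have valE s z : enorm (matfun Omega A *m invmx (matfun v A) *m
    (((nh.+1)`!%:R)^-1 *: matfun (cderiven nh.+1 (fun z => v z * exp_t t z))
      (((1 - s)%:C * z)%:M + s%:C *: A)) *m b) =
  seminorm (((nh.+1)`!%:R)^-1 *: (horner_mx A (char_poly Ah) *m
      invmx (horner_mx A (pole_poly lam kap)))) b
    (matfun (fun z => (iter nh.+1 (dexp t) (pole_poly lam kap)).[z] * exp_t t z)
      (segment_matrix A s z)).
  rewrite /Omega /v !horner_pole_poly wE !matfun_poly cderiven_poly_exp_t.
  by rewrite /seminorm -scalemxAr scalemxAl.
have [M maxM] := error_max A b lam kap muh_inj muhE whE t.
exists M; first by rewrite (eq_image2r _ _ valE).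
rewrite bhE -mulmxA; apply: (error_le_max lam_spectrumA lam_spectrumAh V_isometry
  V_basis AhE muh_inj muhE whE) => s z s01 hz.
by apply: (proj2 maxM); exists s; [rewrite /= in_itv|exists z].
Qed.
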